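(* Let $T_\delta:[0,1]\to[0,1]$, $\delta\in[0,\bar\delta)$, be Borel-measurable maps with $T_\delta=T_0+\delta\cdot\dot T+t_\delta$, where $\dot T,t_\delta\in L^2$ and $\|t_\delta\|_2=o(\delta)$, and let $\rho$ be a Lipschitz probability density on $\mathbb R$ supported on $[-1,1]$. Let $L_\delta:L^2\to L^2$, $L_\delta f(x)=\int k_\delta(x,y)f(y)\,dy$, be the integral operators with kernels $k_\delta(x,y)=(P_\pi\tau_{-T_\delta(y)}\rho)(x)$. Suppose that $L_0$ satisfies (A1): $\lim_{n\to\infty}\|L_0^ng\|_2=0$ for every $g\in V$. Then the kernel $$\dot k(x,y)=-\left(P_\pi\left(\tau_{-T_0(y)}\frac{d\rho}{dx}\right)\right)(x)\cdot\dot T(y)$$ is in $V_{\ker}$ and $$\lim_{\delta\to0}\frac{f_\delta-f_0}{\delta}=-(\mathrm{Id}-L_0)^{-1}\int_0^1\left(P_\pi\left(\tau_{-T_0(y)}\frac{d\rho}{dx}\right)\right)(x)\,\dot T(y)f_0(y)\,dy,$$ with convergence in $L^2$.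
   Context: $L^2=L^2([0,1],\mathbb R)$ with Lebesgue measure $m$; $V:=\{f\in L^2:\int f\,dm=0\}$; $V_{\ker}:=\{k\in L^2([0,1]^2):\int k(x,y)\,dx=0\text{ for a.e. }y\}$. For $b\in\mathbb R$, $(\tau_bg)(x):=g(x+b)$. For $f$ on $\mathbb R$, $P_\pi f(x):=\sum_{i\in2\mathbb Z}(f(i+x)+f(i-x))$, $x\in[0,1]$ (the Perron–Frobenius operator of $\pi(x)=\min_{i\in\mathbb Z}|x-2i|$). $L_\delta$ is the transfer operator of $x_{n+1}=\pi(T_\delta(x_n)+\omega_n)$ with $\omega_n$ i.i.d. of density $\rho$. $d\rho/dx$ is the a.e. derivative. $f_\delta$ denotes the unique $f_\delta\in L^2$ with $L_\delta f_\delta=f_\delta$, $\int f_\delta\,dm=1$ (existing for all small $\delta\ge0$). $(\mathrm{Id}-L_0)^{-1}:V\to V$ is the bounded inverse of $\mathrm{Id}-L_0$ on $V$. *)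

(* Defs.v *)
From HB Require Import structures.
From mathcomp Require Import all_boot all_order all_algebra.
From mathcomp Require Import all_classical all_reals all_analysis.

Set Implicit Arguments.
Unset Strict Implicit.
Unset Printing Implicit Defensive.

Import Order.TTheory GRing.Theory Num.Theory.
Import numFieldNormedType.Exports.

Local Open Scope classical_set_scope.
Local Open Scope ring_scope.

(* A function on [0, 1] (resp. on [0, 1]^2) is represented by a total function
   on R (resp. a curried function on R * R) whose values outside [0, 1] (resp.
   outside [0, 1]^2) are irrelevant: everything below depends only on its
   restriction. Elements of L^2 are such functions, identified by means of
   "f = g %[ae lebesgue_measure in I01 R]" wherever equality in L^2 is meant. *)

Definition I01 (R : realType) : set R := `[0, 1].
Arguments I01 : clear implicits.

Section L2.
Context {R : realType}.
Implicit Types (f g : R -> R) (k : R -> R -> R).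

Local Notation mu := (@lebesgue_measure R).

Definition L2 f := f \_ (I01 R) \in Lfun mu 2%:E.

Definition norm2 f : \bar R := 'N[mu]_2%:E[EFin \o (f \_ (I01 R))]%E.

Definition L2_square k :=
  (fun z : R * R => k z.1 z.2) \_ (I01 R `*` I01 R) \in Lfun (mu \x mu)%E 2%:E.

Definition V f := L2 f /\ \int[mu]_(x in I01 R) f x = 0.

Definition Vker k := L2_square k /\
  {ae mu, forall y, I01 R y -> \int[mu]_(x in I01 R) k x y = 0}.

Definition integral_op k f : R -> R :=
  fun x => \int[mu]_(y in I01 R) (k x y * f y).

Definition tau (b : R) f : R -> R := fun x => f (x + b).

(* The sum over the even integers i = 2 (j - n) is the limit of its symmetric
   partial sums (i ranges over -2n, ..., 2n). *)
Definition P_pi f : R -> R := fun x =>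
  limn (fun n : nat => \sum_(j < n.*2.+1)
    (f (2 * (j%:R - n%:R) + x) + f (2 * (j%:R - n%:R) - x))).

Definition probability_density f :=
  [/\ measurable_fun [set: R] f, forall x, 0 <= f x &
      (\int[mu]_x (f x)%:E = 1)%E].

(* k_delta, where T is the map T_delta and rho the noise density. *)
Definition noise_kernel (rho T : R -> R) : R -> R -> R :=
  fun x y => P_pi (tau (- T y) rho) x.

Definition invariant_density (L : (R -> R) -> R -> R) f :=
  [/\ L2 f, L f = f %[ae mu in I01 R] & \int[mu]_(x in I01 R) f x = 1].

(* S is the bounded inverse of Id - L on V; the second clause says that S is
   well defined on classes modulo a.e. equality. Linearity of S follows from
   that of Id - L. *)
Definition bounded_inverse_on_V (L S : (R -> R) -> R -> R) :=
  [/\ forall g, V g -> V (g \- L g) /\ V (S g),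
      forall g h, V g -> V h -> g = h %[ae mu in I01 R] ->
        S g = S h %[ae mu in I01 R],
      forall g, V g -> S g \- L (S g) = g %[ae mu in I01 R],
      forall g, V g -> S (g \- L g) = g %[ae mu in I01 R] &
      exists C : R, forall g, V g -> (norm2 (S g) <= C%:E * norm2 g)%E].

End L2.

(* Main.v *)
(** Write [f] for the density [L_delta f_delta] (the bounded representative of
    [f_delta]). By (A1) and compactness (the image of a ball of mean-zero
    functions under [L_0] is equi-Lipschitz), some iterate of [L_0] halves the
    sup norm of bounded mean-zero functions, so that [Id - L_0] is inverted by
    a Neumann series. The kernels satisfy
    [|k_delta - k_0| <= 10 Lip(rho) |T_delta - T_0|], hence for small [delta]
    the operator [L_delta] is still contracting and
    [|f_delta - f_0| = O(delta)] uniformly. From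
      [(Id - L_0) (f_delta - f_0) = (L_delta - L_0) f_delta]
    the difference [(f_delta - f_0) / delta - (Id - L_0)^-1 (- q)], [q] being
    the integral of the statement, is [(Id - L_0)^-1] of
    [(L_delta - L_0) f_delta / delta + q]. In the latter [f_delta] may be
    replaced by [f_0] up to [O(delta)], and what remains is the integral of the
    error in the difference quotient of [b |-> P_pi (tau_(-b) rho)] at
    [b = T_0 y] in the direction [Tdot y]. Since [rho] is Lipschitz, that error
    is [O(|Tdot y|)] and tends to [0] almost everywhere, so its [L^1] norm tends
    to [0] by dominated convergence; being uniformly bounded in [x], it also
    tends to [0] in [L^2]. *)

(* Since [Tdot] is merely square integrable, the kernels [k d] are close to [k 0] only in L^1 with
   respect to [y], uniformly in [x]. Such a bound turns bounded functions into bounded functions,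
   and this is why the perturbation argument runs in the sup norm, on representatives for which the
   equations hold at every point. The L^2 norm is kept for the two ends: (A1) is weakened to L^1
   convergence, and the final error is measured in L^2 because the given inverse [S] is only known
   to be bounded there. Since [rho] is only Lipschitz, its derivative exists off a null set;
   elsewhere it takes the default value [0]. That null set has to be avoided in the variable [x], at
   fixed [y]: [T 0] may carry a set of positive measure to a single point, so that at fixed [x] the
   bad [y] need not be negligible. Hence the L^1 norm in [x] and an exchange of integrals. The
   contraction factor is [1 / 2] for [k 0] and [3 / 4] for [k d]; the gap is the budget of the
   perturbation. *)
Require Import Defs.
From HB Require Import structures.
From mathcomp Require Import all_boot all_order all_algebra.
From mathcomp Require Import all_classical all_reals all_analysis.
From mathcomp Require Import measurable_realfun.
From mathcomp Require Import ring lra.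

Set Implicit Arguments.
Unset Strict Implicit.
Unset Printing Implicit Defensive.

Import Order.TTheory GRing.Theory Num.Theory.
Import numFieldNormedType.Exports.

Local Open Scope classical_set_scope.
Local Open Scope ring_scope.

(** * Almost everywhere differentiability of Lipschitz functions *)

Section normalized_clip.
Context {R : realType} (K a b : R) (f : R -> R).
Hypothesis K0 : 0 < K.
Hypothesis ab : a < b.
Hypothesis fK : forall x y, `|f x - f y| <= K * `|x - y|.

(* [g] is increasing with slopes between [K] and [3 K]: clipped to [a, b] and
   normalized, it is the distribution function of a probability measure
   dominated by a multiple of Lebesgue measure, and Radon-Nikodym and Lebesgue
   differentiation apply. *)
Let clip (x : R) := Num.max a (Num.min b x).
Let g x := f x + 2 * K * x.
Definition normalized_clip (x : R) := (g (clip x) - g a) / (g b - g a).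

Let clip_le x y : x <= y -> clip x <= clip y.
Proof.
by move=> xy; rewrite /clip le_max2// le_min2.
Qed.

Let clip_lip x y : x <= y -> clip y - clip x <= y - x.
Proof.
move=> xy; rewrite /clip /Num.max /Num.min; do !case: ifPn => //; rewrite -?leNgt; lra.
Qed.

Let g_le x y : x <= y -> K * (y - x) <= g y - g x <= 3 * K * (y - x).
Proof.
move=> xy; have := fK y x; rewrite (ger0_norm (_ : 0 <= y - x)) ?subr_ge0// ler_norml /g => /andP[h1 h2].
by apply/andP; split; lra.
Qed.

Let gab : 0 < g b - g a.
Proof.
have /andP[h _] := g_le (ltW ab); apply: lt_le_trans h.
by rewrite mulr_gt0// subr_gt0.
Qed.

Lemma normalized_clip_nd : {homo normalized_clip : x y / x <= y}.
Proof.
move=> x y xy; rewrite ler_pM2r ?invr_gt0// lerD2r.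
have /andP[h _] := g_le (clip_le xy); rewrite -subr_ge0; apply: le_trans h.
by rewrite mulr_ge0 ?(ltW K0)// subr_ge0 clip_le.
Qed.

Lemma normalized_clip_lip x y : x <= y ->
  normalized_clip y - normalized_clip x <= 3 * K / (g b - g a) * (y - x).
Proof.
move=> xy; rewrite -mulrBl [leRHS]mulrAC ler_pM2r ?invr_gt0//.
have /andP[_ h] := g_le (clip_le xy).
have K3 : 0 <= 3 * K by rewrite mulr_ge0// ltW.
have h2 := ler_wpM2l K3 (clip_lip xy).
by rewrite opprB addrA subrK (le_trans h).
Qed.

Lemma normalized_clip_rc : right_continuous normalized_clip.
Proof.
apply/right_continuousW => x.
pose C := 3 * K / (g b - g a).
have C0 : 0 < C by rewrite divr_gt0// mulr_gt0.
apply/cvgrPdist_le => e e0; near=> y.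
apply: (@le_trans _ _ (C * `|x - y|)); last first.
  rewrite -ler_pdivlMl// mulrC; near: y.
  by exists (e / C); [exact: divr_gt0|move=> z /ltW].
have [xy|/ltW yx] := leP x y.
- rewrite distrC [X in C * X]distrC !ger0_norm ?subr_ge0//; last exact: normalized_clip_nd.
  exact: normalized_clip_lip.
- rewrite !ger0_norm ?subr_ge0//; last exact: normalized_clip_nd.
  exact: normalized_clip_lip.
Unshelve. all: by end_near. Qed.

Lemma normalized_clip_le x : x <= a -> normalized_clip x = 0.
Proof.
move=> xa; rewrite /normalized_clip /clip.
by rewrite (min_idPr _) ?(le_trans xa) ?(ltW ab)// (max_idPl _)// subrr mul0r.
Qed.

Lemma normalized_clip_ge x : b <= x -> normalized_clip x = 1.
Proof.
move=> xa; rewrite /normalized_clip /clip.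
by rewrite (min_idPl _)// (max_idPr _) ?(ltW ab)// divff ?gt_eqF.
Qed.

Lemma normalized_clip_Ny : normalized_clip @ -oo --> (0 : R).
Proof.
apply: cvg_near_cst; near=> x; apply: normalized_clip_le.
by near: x; apply: nbhs_ninfty_le; rewrite num_real.
Unshelve. all: by end_near. Qed.

Lemma normalized_clip_y : normalized_clip @ +oo --> (1 : R).
Proof.
apply: cvg_near_cst; near=> x; apply: normalized_clip_ge.
by near: x; apply: nbhs_pinfty_ge; rewrite num_real.
Unshelve. all: by end_near. Qed.

HB.instance Definition _ := isCumulative.Build R _ R normalized_clip
  normalized_clip_nd normalized_clip_rc.
HB.instance Definition _ := isCumulativeBounded.Build R 0 1 normalized_clip
  normalized_clip_Ny normalized_clip_y.

Let F : cumulativeBounded (0:R) (1:R) := normalized_clip.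
Let nu := lebesgue_stieltjes_measure F.
Local Notation mu := (@lebesgue_measure R).

Let C := 3 * K / (g b - g a).
Let C0 : 0 < C. Proof. by rewrite divr_gt0// mulr_gt0. Qed.

Let wlength_le (A : set R) : ocitv A ->
  (wlength normalized_clip A <= C%:E * wlength idfun A)%E.
Proof.
move=> [[x y] _ <-]/=; have [xy|yx] := leP x y; last first.
  by rewrite set_itv_ge ?bnd_simp -?leNgt ?(ltW yx)// !wlength0 mule0.
by rewrite !wlength_itv_bnd// -EFinM lee_fin; exact: normalized_clip_lip.
Qed.

(** Both measures are infima over countable covers by half-open intervals, so the comparison of
    interval lengths in [wlength_le] passes to every set. *)
Let nu_le (A : set R) : (nu A <= C%:E * mu A)%E.
Proof.
rewrite -lee_pdivrMl//; apply: le_ereal_inf_tmp => _ [S [mS AS] <-].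
rewrite lee_pdivrMl//.
apply: (@le_trans _ _ (\sum_(0 <= k <oo) wlength normalized_clip (S k))%E).
  by apply: ereal_inf_lbound; exists S.
rewrite -nneseriesZl; last by move=> k _; exact: wlength_ge0.
by apply: lee_nneseries => [k _ _|k _]; [exact: wlength_ge0|exact/wlength_le/mS].
Qed.

Let nu_dominated : nu `<< mu.
Proof.
apply/null_content_dominatesP => A mA muA0; apply/eqP.
rewrite eq_le measure_ge0 andbT (le_trans (nu_le A))//.
by rewrite (_ : mu A = 0%E) ?mule0.
Qed.

Let nu_itv x y : x <= y ->
  nu `]x, y] = (normalized_clip y - normalized_clip x)%:E.
Proof.
move=> xy; rewrite /nu /lebesgue_stieltjes_measure /measure_extension.
by rewrite measurable_mu_extE/= ?wlength_itv_bnd//; exact: is_ocitv.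
Qed.

(** One-dimensional Rademacher theorem. Inside []a, b[] the clipping does nothing, so [f] is
    recovered from the primitive [H] of the Radon-Nikodym density by an affine map and the linear
    term [- 2 * K * y]. *)
Lemma lipschitz_ae_derivable_itv :
  {ae mu, forall x, a < x < b -> derivable f x 1}.
Proof.
have [h [h0 hfin inth nuE]] := radon_nikodym_sigma_finite nu_dominated.
have inth' : mu.-integrable setT (EFin \o (fine \o h)).
  by apply: eq_integrable inth => // x _ /=; rewrite fineK.
have iS A : measurable A -> mu.-integrable A (EFin \o (fine \o h)).
  by move=> mA; exact: integrableS inth'.
have := FTC1 (a := BRight a) (f := fine \o h) (fun y => iS _ (measurable_itv _)).
move/(_ (open_integrable_locally openT inth')).
apply: filterS; first exact: (ae_filter_ringOfSetsType mu).
move=> x + /andP[ax xb].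
rewrite lte_fin => /(_ ax)[+ _].
set H := (fun x => \int[mu]_(t in _) _).
move=> dH.
have HE y : a <= y -> H y = normalized_clip y.
  move=> ay; rewrite /H /Rintegral.
  rewrite (eq_integral h); last by move=> z _ /=; rewrite fineK.
  have -> : (\int[mu]_(t in `]a, y]) h t)%E = nu `]a, y].
    by apply/esym; exact: nuE.
  by rewrite nu_itv//= (normalized_clip_le (lexx a)) subr0.
have : derivable (fun y => (g b - g a) * H y + (g a - 2 * K * y)) x 1.
  apply: derivableD; first exact: derivableM.
  by apply: derivableB => //; apply: derivableM.
apply: near_eq_derivable; near=> y.
have ay : a < y by near: y; exact: lt_nbhsr.
have yb : y < b by near: y; exact: lt_nbhsl.
rewrite HE ?ltW// /normalized_clip /clip (min_idPr _) ?ltW// (max_idPr _) ?ltW//.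
rewrite mulrCA divff ?gt_eqF// mulr1 /g; ring.
Unshelve. all: by end_near. Qed.
End normalized_clip.

(** * Measurability of the derivative *)

Section measurable_derive1.
Context {R : realType} (f : R -> R).

Let q (h x : R) := h^-1 * (f (h + x) - f x).

(* The points where the difference quotients are Cauchy. *)
Let D := \bigcap_k \bigcup_n [set x | forall h h' : R,
  0 < `|h| < n.+1%:R^-1 -> 0 < `|h'| < n.+1%:R^-1 ->
  `|q h x - q h' x| <= k.+1%:R^-1].

Let qE x : (fun h => h^-1 *: ((f \o shift x) (h *: 1) - f x)) = q ^~ x.
Proof. by apply/funext => h /=; rewrite /q [h *: 1]mulr1. Qed.

Let derivableP x : D x <-> derivable f x 1.
Proof.
rewrite /derivable qE; split.
- move=> Dx; apply/cauchy_cvgP/cauchy_exP => e e0.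
  have [k ke] : exists k, k.+1%:R^-1 < e.
    have [k _ /(_ _ (leqnn k)) h] := near_infty_natSinv_lt (PosNum e0).
    by exists k.
  (* The centre of the Cauchy ball is the quotient at half of [n.+1%:R^-1], which meets the strict
     bound in [D]. *)
  have [n _ nP] := Dx k I; exists (q (n.+1%:R^-1 / 2) x).
  have n0 : 0 < (n.+1%:R^-1 : R) by rewrite invr_gt0.
  move: nP => /= nP; near=> h.
  rewrite -ball_normE /=.
  apply: le_lt_trans ke.
  apply: nP.
  + by rewrite gtr0_norm ?divr_gt0//= ltr_pdivrMr// ltr_pMr// ltr1n.
  + rewrite normr_gt0; apply/andP; split; near: h; first exact: nbhs_dnbhs_neq.
    exact: dnbhs0_lt.
- move=> /cvg_ex[/= l ql] k _.
  have k0 : 0 < (k.+1%:R^-1 / 2 : R) by rewrite divr_gt0// invr_gt0.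
  have /cvgrPdist_le/(_ _ k0) := ql.
  rewrite near_withinE => -[e /= e0 eP].
  have [n _ /(_ _ (leqnn n)) ne] := near_infty_natSinv_lt (PosNum e0).
  have qn h : 0 < `|h| < n.+1%:R^-1 -> `|l - q h x| <= k.+1%:R^-1 / 2.
    move=> /andP[h0 hn]; apply: eP; last by rewrite -normr_gt0.
    by rewrite /= sub0r normrN (lt_trans hn).
  exists n => // h h' /qn h1 /qn h2.
  rewrite (_ : q h x - q h' x = (l - q h' x) - (l - q h x)); last by ring.
  by rewrite (le_trans (ler_normB _ _))// [leRHS]splitr lerD.
Unshelve. all: by end_near. Qed.

Hypothesis cf : continuous f.

Let cq h : continuous (q h).
Proof.
move=> x; apply: cvgM; first exact: cvg_cst.
apply: cvgB; last exact: cf.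
apply: continuous_comp; last exact: cf.
by apply: cvgD; [exact: cvg_cst|exact: cvg_id].
Qed.

(** For fixed [k] and [n] the condition in [D] is an intersection, over all pairs of steps, of
    closed conditions on [x], because each [q h] is continuous. The intersection is uncountable, but
    closedness survives it. *)
Lemma measurable_derivable : measurable ([set x | derivable f x 1] : set R).
Proof.
rewrite (_ : [set x | _] = D); last by apply/seteqP; split => x /derivableP.
apply: bigcap_measurable => // k _; apply: bigcup_measurable => n _.
apply: closed_measurable.
pose P := [set p : R * R | 0 < `|p.1| < n.+1%:R^-1 /\ 0 < `|p.2| < n.+1%:R^-1].
rewrite (_ : [set x | _] = \bigcap_(p in P)
   ((fun x => `|q p.1 x - q p.2 x|) @^-1` [set r | r <= k.+1%:R^-1])); last first.
  apply/seteqP; split => [x xP [h h'] []|x xP h h' hn h'n]; first exact: xP.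
  exact: (xP (h, h')).
apply: closed_bigI => p _; apply: closed_comp (@closed_le _ _).
by move=> x _; apply: cvg_norm; apply: cvgB; exact: cq.
Qed.

Lemma cvg_derive1 (u : R^nat) x : (forall n, u n != 0) -> u @ \oo --> 0 ->
  derivable f x 1 ->
  (u n)^-1 * (f (u n + x) - f x) @[n --> \oo] --> (f^`())%classic x.
Proof.
move=> u0 cu; rewrite /derivable qE => dq.
apply: (cvg_comp u (q ^~ x) (G := 0^')); last exact: dq.
by move=> A /cu[N _ NA]; exists N => // n /NA; apply.
Qed.

(** The limit of a divergent filter is the default [point], which is [0] in [R]. This makes the
    derivative measurable and bounded everywhere, and not only where it exists. *)
Let derive1_ndvg x : ~ derivable f x 1 -> (f^`())%classic x = point.
Proof. by rewrite /derivable qE => /dvgP. Qed.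

(** Pointwise limit of the quotients at steps [n.+1%:R^-1], cut off to the set of differentiability;
    off that set the cut-off and the derivative have the same default value. *)
Lemma measurable_derive1 : measurable_fun (setT : set R) (f^`())%classic.
Proof.
pose D' : set R := [set x | derivable f x 1].
have mD' : measurable D' by exact: measurable_derivable.
have mq n : measurable_fun setT (q n.+1%:R^-1 \_ D').
  rewrite -measurable_restrictT//; apply: measurable_funTS.
  exact: continuous_measurable_fun.
apply: (measurable_fun_cvg mq) => x _.
have [xD|xD] := pselect (D' x).
  rewrite (_ : (fun n => _) = (fun n => q n.+1%:R^-1 x)); last first.
    by apply/funext => n; rewrite patchE mem_set.
  by apply: cvg_derive1 => //; exact: cvg_harmonic.
rewrite (_ : (fun n => _) = cst point); last first.
  by apply/funext => n; rewrite patchE memNset.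
by rewrite derive1_ndvg//; exact: cvg_cst.
Qed.

Lemma derive1_norm_le (K : R) x : 0 <= K ->
  (forall x y, `|f x - f y| <= K * `|x - y|) -> `|(f^`())%classic x| <= K.
Proof.
move=> K0 fK; have [dx|ndx] := pselect (derivable f x 1).
  have h := cvg_derive1 (fun n => lt0r_neq0 (harmonic_gt0 n)) (@cvg_harmonic R) dx.
  apply: (ler_cvg_to (cvg_norm h) (cvg_cst K)); apply: nearW => n.
  rewrite normrM normfV ler_pdivrMl ?normr_gt0 ?gt_eqF ?harmonic_gt0//.
  by rewrite (le_trans (fK _ _))// addrK mulrC.
by rewrite derive1_ndvg// (_ : point = 0) ?normr0.
Qed.
End measurable_derive1.

(** * Norms on the unit interval *)

Section L2_interval.
Context {R : realType}.
Implicit Types (f g : R -> R) (B : R).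
Local Notation mu := (@lebesgue_measure R).
Local Notation I := (I01 R).
Local Notation integrable01 f := (mu.-integrable I (EFin \o f)).

Lemma measurable_I01 : measurable (I01 R : set R).
Proof. exact: measurable_itv. Qed.
Hint Resolve measurable_I01 : core.

Lemma I01P (x : R) : I01 R x <-> 0 <= x <= 1.
Proof. by rewrite /I01/= in_itv. Qed.

(** Evaluating a bound [|f x| <= B] at this point is how [0 <= B] is obtained throughout. *)
Lemma I01_0 : I01 R 0.
Proof. by apply/I01P; rewrite lexx ler01. Qed.

Lemma mu_I01 : mu (I01 R) = 1%E.
Proof. by rewrite lebesgue_measure_itv/= lte_fin ltr01 -EFinB subr0. Qed.

Lemma mu_I01_lty : (mu (I01 R) < +oo)%E.
Proof. by rewrite mu_I01 ltry. Qed.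

Lemma le_integrable01 f g : measurable_fun I f ->
  (forall x, I x -> `|f x| <= g x) -> integrable01 g -> integrable01 f.
Proof.
move=> mf fg; apply: le_integrable => //; first exact/measurable_EFinP.
move=> x Ix /=; rewrite lee_fin (le_trans (fg x Ix))//.
exact: ler_norm.
Qed.

Lemma integrable01_cst B : integrable01 (fun=> B).
Proof.
apply: measurable_bounded_integrable => //; first exact: mu_I01_lty.
by exists `|B|; split; [rewrite num_real|move=> M BM x _; exact: ltW].
Qed.

Lemma bounded_integrable01 f B : measurable_fun I f ->
  (forall x, I x -> `|f x| <= B) -> integrable01 f.
Proof. by move=> mf fB; apply: le_integrable01 mf fB _; exact: integrable01_cst. Qed.

Lemma Rintegral01_cst B : \int[mu]_(x in I) B = B.
Proof.
by rewrite Rintegral_cst// (_ : fine _ = 1) ?mulr1// -[RHS]/(fine 1%E) -mu_I01.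
Qed.

Lemma integrable01_measurable f : integrable01 f -> measurable_fun I f.
Proof. by move=> /measurable_int/measurable_EFinP. Qed.

Lemma integral01_cst B : (\int[mu]_(x in I) B%:E = B%:E)%E.
Proof.
by rewrite integral_cst// -[RHS]mule1; congr (_ * _)%E; exact: mu_I01.
Qed.

Definition norm1 f := \int[mu]_(x in I) `|f x|.

Lemma integrable01_norm f : integrable01 f -> integrable01 (fun x => `|f x|).
Proof. exact: integrable_norm. Qed.

Lemma integrable01D f g : integrable01 f -> integrable01 g ->
  integrable01 (fun x => f x + g x).
Proof. by move=> intf intg; exact: (integrableD _ intf intg). Qed.

Lemma integrable01B f g : integrable01 f -> integrable01 g ->
  integrable01 (fun x => f x - g x).
Proof. by move=> intf intg; exact: (integrableB _ intf intg). Qed.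

Lemma integrable01Z c f : integrable01 f -> integrable01 (fun x => c * f x).
Proof. by move=> intf; exact: (integrableZl _ c intf). Qed.

Lemma norm1_ge0 f : 0 <= norm1 f.
Proof. by apply: Rintegral_ge0. Qed.

Lemma norm1_le f B : measurable_fun I f -> (forall x, I x -> `|f x| <= B) ->
  norm1 f <= B.
Proof.
move=> mf fB; rewrite -[leRHS]Rintegral01_cst; apply: le_Rintegral => //.
  exact/integrable01_norm/(bounded_integrable01 mf fB).
exact: integrable01_cst.
Qed.

Lemma ae_eq01_Rintegral f g : measurable_fun I f -> measurable_fun I g ->
  f = g %[ae mu in I] -> \int[mu]_(x in I) f x = \int[mu]_(x in I) g x.
Proof.
move=> mf mg fg; congr fine; apply: ae_eq_integral => //.
- exact/measurable_EFinP.
- exact/measurable_EFinP.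
- by apply: filterS fg; [exact: (ae_filter_ringOfSetsType mu)|move=> x /= + Ix => ->].
Qed.

Lemma norm2E f :
  norm2 f = ((\int[mu]_(x in I) ((f x) ^+ 2)%:E) `^ 2^-1)%E.
Proof.
rewrite /norm2 unlock [in RHS]integral_mkcond; congr (_ `^ _)%E.
apply: eq_integral => x _ /=; rewrite !patchE; case: ifPn => _.
  by rewrite powR_mulrn// real_normK// num_real.
by rewrite (_ : point = 0 :> R)// normr0 powR0 ?pnatr_eq0.
Qed.

Lemma norm2_ge0 f : (0 <= norm2 f)%E.
Proof. exact: Lnorm_ge0. Qed.

Lemma norm2_ltyP f : (norm2 f < +oo)%E <->
  (\int[mu]_(x in I) ((f x) ^+ 2)%:E < +oo)%E.
Proof.
rewrite norm2E; split => [|foo]; last by rewrite poweR_lty.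
rewrite !ltey; apply: contra => /eqP ->.
by rewrite poweRyr ?invr_eq0 ?pnatr_eq0.
Qed.

Lemma L2P f : L2 f <-> measurable_fun I f /\ (norm2 f < +oo)%E.
Proof.
rewrite /L2 measurable_restrictT//; split => [/andP[]|[]].
  by rewrite !inE.
by move=> mf foo; rewrite inE; apply/andP; split; rewrite inE.
Qed.

Lemma L2_measurable f : L2 f -> measurable_fun I f.
Proof. by move=> /L2P[]. Qed.

Lemma norm2_fin_num f : L2 f -> norm2 f \is a fin_num.
Proof. by move=> /L2P[_ ?]; rewrite ge0_fin_numE// norm2_ge0. Qed.

(** Cauchy-Schwarz against the constant [1], whose norm is [1] on an interval of measure [1]. *)
Lemma norm1_le_norm2 f : L2 f -> integrable01 f /\ norm1 f <= fine (norm2 f).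
Proof.
move=> L2f; have mf := L2_measurable L2f.
have mf' : measurable_fun setT (f \_ I) by rewrite -measurable_restrictT.
pose one : R -> R := fun=> 1.
have m1 : measurable_fun setT (one \_ I).
  by rewrite -measurable_restrictT//; exact: measurable_cst.
have N1 : norm2 one = 1%E.
  rewrite norm2E (_ : integral _ _ _ = 1%E) ?poweR1r//.
  under eq_integral do rewrite /one expr1n.
  by rewrite integral_cst// mul1e; exact: mu_I01.
have /(_ _ _)/= := hoelder mu mf' m1 (p := 2) (q := 2).
have h2 : 2^-1 + 2^-1 = 1 :> R by lra.
move=> /(_ (ltr0n _ 2) (ltr0n _ 2) h2).
rewrite -/(norm2 f) -/(norm2 one) Lnorm1.
rewrite N1 mule1.
have -> : (\int[mu]_x `|(EFin \o (f \_ I \* one \_ I)%R) x| =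
     \int[mu]_(x in I) `|f x|%:E)%E.
  rewrite [RHS]integral_mkcond; apply: eq_integral => x _ /=.
  by rewrite !patchE; case: ifPn => _; rewrite ?mulr1// (_ : point = 0 :> R)// mul0r normr0.
move=> h; have fi : integrable01 f.
  apply/integrableP; split; first exact/measurable_EFinP.
  by apply: le_lt_trans h _; rewrite ltey_eq norm2_fin_num.
by split => //; rewrite /norm1 /Rintegral fine_le ?norm2_fin_num// integrable_fin_num// integrable01_norm.
Qed.

Lemma norm2_bounded f B : measurable_fun I f -> (forall x, I x -> `|f x| <= B) ->
  (norm2 f <= B%:E)%E.
Proof.
move=> mf fB; have B0 : 0 <= B.
  by rewrite (le_trans _ (fB 0 I01_0)).
rewrite norm2E (_ : B%:E = ((B ^+ 2)%:E `^ 2^-1)%E); last first.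
  by rewrite poweR_EFin powR12_sqrt ?sqr_ge0// sqrtr_sqr ger0_norm.
apply: gt0_ler_poweR; rewrite ?in_itv/= ?leey ?andbT ?integral_ge0//.
- by move=> x _; rewrite lee_fin sqr_ge0.
- by rewrite lee_fin sqr_ge0.
- rewrite -[leRHS]mule1 -mu_I01 -integral_cst//; apply: ge0_le_integral => //.
  + by move=> x _; rewrite lee_fin sqr_ge0.
  + by apply/measurable_EFinP; exact: measurable_funX.
  + by move=> x Ix; rewrite lee_fin -real_normK ?num_real// lerXn2r ?nnegrE// fB.
Qed.

Lemma bounded_L2 f B : measurable_fun I f -> (forall x, I x -> `|f x| <= B) -> L2 f.
Proof.
move=> mf fB; apply/L2P; split => //.
by rewrite (le_lt_trans (norm2_bounded mf fB))// ltry.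
Qed.

(** From [f ^+ 2 <= B * |f|]. This converts L^1 smallness of the final error into L^2 smallness. *)
Lemma norm2_interpolation f B : measurable_fun I f -> (forall x, I x -> `|f x| <= B) ->
  (norm2 f <= (Num.sqrt (B * norm1 f))%:E)%E.
Proof.
move=> mf fB; have intf := bounded_integrable01 mf fB.
have B0 : 0 <= B.
  by rewrite (le_trans _ (fB 0 I01_0)).
rewrite norm2E -powR12_sqrt ?mulr_ge0 ?norm1_ge0// -poweR_EFin.
apply: gt0_ler_poweR; rewrite ?in_itv/= ?leey ?andbT ?integral_ge0//.
- by move=> x _; rewrite lee_fin sqr_ge0.
- by rewrite lee_fin mulr_ge0 ?norm1_ge0.
- have iBf : integrable01 (fun x => B * `|f x|).
    exact/integrable01Z/integrable01_norm.
  rewrite /norm1 -RintegralZl//; last exact: integrable01_norm.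
  rewrite fineK; last exact: integrable_fin_num.
  apply: ge0_le_integral => //.
  + by move=> x _; rewrite lee_fin sqr_ge0.
  + by apply/measurable_EFinP; exact: measurable_funX.
  + by move/measurable_int : iBf.
  + by move=> x Ix; rewrite lee_fin -real_normK ?num_real// expr2 ler_wpM2r// fB.
Qed.

Lemma norm2D f g : measurable_fun I f -> measurable_fun I g ->
  (norm2 (fun x => f x + g x)%R <= norm2 f + norm2 g)%E.
Proof.
move=> mf mg; rewrite /norm2 (_ : _ \_ I = (f \_ I \+ g \_ I)); last first.
  by apply/funext => x /=; rewrite !patchE; case: ifPn => _ //; rewrite addr0.
by apply: minkowski_EFin; rewrite ?ler1n// -measurable_restrictT.
Qed.

Lemma ae_eq_norm2 f g : measurable_fun I f -> measurable_fun I g ->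
  f = g %[ae mu in I] -> norm2 f = norm2 g.
Proof.
move=> mf mg fg; rewrite !norm2E; congr (_ `^ _)%E.
apply: ge0_ae_eq_integral => //.
- by apply/measurable_EFinP; exact: measurable_funX.
- by apply/measurable_EFinP; exact: measurable_funX.
- by move=> x _; rewrite lee_fin sqr_ge0.
- by move=> x _; rewrite lee_fin sqr_ge0.
- by apply: filterS fg; [exact: (ae_filter_ringOfSetsType mu)|move=> x /= + Ix => ->].
Qed.

End L2_interval.

(** * Fubini on the unit square for kernels dominated by a function of [y] *)

Section fubini_interval.
Context {R : realType}.
Local Notation mu := (@lebesgue_measure R).
Local Notation I := (I01 R).
Local Notation integrable01 f := (mu.-integrable I (EFin \o f)).
#[local] Hint Extern 0 (measurable (I01 _)) => solve [exact: measurable_I01] : core.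

Variables (G : R -> R -> R) (h : R -> R).
Hypothesis mG : measurable_fun (I `*` I) (fun z : R * R => G z.1 z.2).
Hypothesis Gh : forall x y, I x -> I y -> `|G x y| <= h y.
Hypothesis inth : integrable01 h.

Let mII : measurable (I `*` I : set (R * R)).
Proof. exact: measurableX. Qed.

Lemma measurable_sectionx x : I x -> measurable_fun I (G x).
Proof.
move=> Ix.
suff : measurable_fun I ((fun z : R * R => G z.1 z.2) \o pair x) by [].
apply: (measurable_comp mII _ mG).
  by move=> _ [y Iy <-].
by apply: measurable_funTS; exact: pair1_measurable.
Qed.

Lemma measurable_sectiony y : I y -> measurable_fun I (G ^~ y).
Proof.
move=> Iy.
suff : measurable_fun I ((fun z : R * R => G z.1 z.2) \o pair^~ y) by [].
apply: (measurable_comp mII _ mG).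
  by move=> _ [x Ix <-].
by apply: measurable_funTS; exact: pair2_measurable.
Qed.

Lemma integrable01_sectionx x : I x -> integrable01 (G x).
Proof.
move=> Ix; apply: le_integrable01 inth => [|y Iy]; last exact: Gh.
exact: measurable_sectionx.
Qed.

Lemma integrable01_sectiony y : I y -> integrable01 (G ^~ y).
Proof.
move=> Iy; apply: (bounded_integrable01 (B := h y)) => [|x Ix]; last exact: Gh.
exact: measurable_sectiony.
Qed.

(** Extension by zero to the plane, where the theorems of Fubini and Tonelli are applied. *)
Let F : R * R -> \bar R := EFin \o ((fun z => G z.1 z.2) \_ (I `*` I)).

Let FE x y : F (x, y) = if (x \in I) && (y \in I) then (G x y)%:E else 0%E.
Proof. by rewrite /F /= patchE in_setX/=; case: ifPn. Qed.

Let mF : measurable_fun setT F.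
Proof.
apply/measurable_EFinP.
by rewrite -measurable_restrictT.
Qed.

Let Fx x : (\int[mu]_y F (x, y) = (((fun x => (\int[mu]_(y in I) G x y)%R) \_ I) x)%:E)%E.
Proof.
rewrite patchE; case: ifPn => xI; last first.
  by rewrite integral0_eq// => y _; rewrite FE (negbTE xI).
rewrite fineK; last first.
  by apply: (integrable_fin_num _ (integrable01_sectionx (set_mem xI))).
rewrite [RHS]integral_mkcond; apply: eq_integral => y _.
by rewrite FE xI patchE/=; case: ifPn.
Qed.

Let Fy y : (\int[mu]_x F (x, y) = (((fun y => (\int[mu]_(x in I) G x y)%R) \_ I) y)%:E)%E.
Proof.
rewrite patchE; case: ifPn => yI; last first.
  by rewrite integral0_eq// => x _; rewrite FE (negbTE yI) andbF.
rewrite fineK; last first.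
  by apply: (integrable_fin_num _ (integrable01_sectiony (set_mem yI))).
rewrite [RHS]integral_mkcond; apply: eq_integral => x _.
by rewrite FE yI patchE/= andbT; case: ifPn.
Qed.

(** Tonelli with [x] integrated first: the bound [h y] is constant in [x] and the interval has mass
    [1], so the inner integral is again at most [h y]. *)
Lemma integrable_square : (mu \x mu)%E.-integrable setT
  (EFin \o ((fun z : R * R => G z.1 z.2) \_ (I `*` I))).
Proof.
rewrite -/F; apply/integrable21ltyP => //.
apply: (@le_lt_trans _ _ (\int[mu]_y (EFin \o h \_ I) y)%E); last first.
  rewrite (_ : EFin \o _ = (EFin \o h) \_ I); last first.
    by apply/funext => x /=; rewrite !patchE/=; case: ifPn.
  by rewrite -integral_mkcond integrable_lty.
apply: ge0_le_integral => //.
- by move=> y _; exact: integral_ge0.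
- have maF : measurable_fun setT (fun z => `|F z|%E) by exact: measurableT_comp.
  exact: (@measurable_fun_fubini_tonelli_G _ _ (measurableTypeR R)
    (measurableTypeR R) R mu _ maF (fun z => abse_ge0 (F z))).
- apply/measurable_EFinP; rewrite -measurable_restrictT//.
  exact: integrable01_measurable.
move=> y _; rewrite [leRHS]/= patchE; case: ifPn => yI; last first.
  rewrite integral0_eq// => x _.
  by rewrite FE (negbTE yI) andbF abse0.
apply: (@le_trans _ _ (\int[mu]_(x in I) (h y)%:E)%E); last first.
  by rewrite integral01_cst.
rewrite [leRHS]integral_mkcond; apply: ge0_le_integral => //.
- apply: measurableT_comp => //.
  exact: (measurableT_comp mF (pair2_measurable y)).
- by rewrite -measurable_restrictT.
move=> x _; rewrite FE yI patchE andbT; case: ifPn => xI; last by rewrite abse0.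
by rewrite lee_fin Gh//; exact: set_mem.
Qed.

Lemma integrable01_Rintegral1 : integrable01 (fun x => \int[mu]_(y in I) G x y).
Proof.
have iF := integrable_fubini_F integrable_square.
apply/integrable_mkcond => //; apply: eq_integrable iF => // x _.
by rewrite /fubini_F Fx !patchE; case: ifPn.
Qed.

Lemma integrable01_Rintegral2 : integrable01 (fun y => \int[mu]_(x in I) G x y).
Proof.
apply: le_integrable01 inth => [|y Iy].
  have mFG := measurable_fubini_G integrable_square.
  suff : measurable_fun setT ((fun y => \int[mu]_(x in I) G x y) \_ I).
    by rewrite -measurable_restrictT.
  apply/measurable_EFinP; apply: eq_measurable_fun mFG => y _.
  by rewrite /fubini_G Fy.
apply: (le_trans (le_normr_Rintegral _ (integrable01_sectiony Iy))) => //.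
by apply: norm1_le => [|x Ix]; [exact: measurable_sectiony|exact: Gh].
Qed.

Lemma Rintegral01_fubini :
  \int[mu]_(x in I) \int[mu]_(y in I) G x y = \int[mu]_(y in I) \int[mu]_(x in I) G x y.
Proof.
have := Fubini integrable_square.
under eq_integral do rewrite Fx.
under [in X in _ = X -> _]eq_integral do rewrite Fy.
move=> /(congr1 fine); rewrite -!/(Rintegral _ _ _).
by rewrite -!Rintegral_mkcond.
Qed.

End fubini_interval.

(** * Integral operators with stochastic kernels *)

Section stochastic_kernel.
Context {R : realType}.
Local Notation mu := (@lebesgue_measure R).
Local Notation I := (I01 R).
Local Notation integrable01 f := (mu.-integrable I (EFin \o f)).
#[local] Hint Extern 0 (measurable (I01 _)) => solve [exact: measurable_I01] : core.

(** A bounded Markov kernel, with [y] the starting point and [x] the arrival. The normalization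
    makes [integral_op k] preserve integrals; the bound [M] makes it send integrable functions to
    bounded ones. *)
Definition stochastic_kernel (k : R -> R -> R) (M : R) :=
  [/\ measurable_fun (I `*` I) (fun z : R * R => k z.1 z.2),
      forall x y, I x -> I y -> 0 <= k x y <= M &
      forall y, I y -> \int[mu]_(x in I) k x y = 1].

Lemma integral_op_eq_in k (f g : R -> R) x :
  (forall y, I y -> f y = g y) -> integral_op k f x = integral_op k g x.
Proof.
by move=> fg; apply: eq_Rintegral => y /set_mem Iy; rewrite fg.
Qed.

Lemma iter_integral_op_eq_in k (f g : R -> R) n x :
  (forall y, I y -> f y = g y) -> I x ->
  iter n (integral_op k) f x = iter n (integral_op k) g x.
Proof.
move=> fg; elim: n x => [|n IH] x Ix /=; first exact: fg.
exact: integral_op_eq_in.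
Qed.

Context (k : R -> R -> R) (M : R).
Hypothesis kP : stochastic_kernel k M.
Local Notation L := (integral_op k).

Let k0 x y : I x -> I y -> 0 <= k x y.
Proof. by case: kP => _ h _ Ix Iy; have /andP[] := h _ _ Ix Iy. Qed.

Let kM x y : I x -> I y -> `|k x y| <= M.
Proof.
by case: kP => _ h _ Ix Iy; have /andP[? ?] := h _ _ Ix Iy; rewrite ger0_norm.
Qed.

Lemma stochastic_kernel_ge0 : 0 <= M.
Proof. exact: le_trans (normr_ge0 _) (kM I01_0 I01_0). Qed.
Let M0 := stochastic_kernel_ge0.

Let mk := let: And3 h _ _ := kP in h.

Let mkf f : measurable_fun I f ->
  measurable_fun (I `*` I) (fun z : R * R => k z.1 z.2 * f z.2).
Proof.
move=> mf; apply: measurable_funM => //.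
apply: (measurable_comp measurable_I01 _ mf).
  by move=> _ [[x y] [_ Iy] <-].
by apply: measurable_funTS; exact: measurable_snd.
Qed.

Let kf_le f x y : I x -> I y -> `|k x y * f y| <= M * `|f y|.
Proof. by move=> Ix Iy; rewrite normrM ler_wpM2r// kM. Qed.

Lemma integrable_kernelM f x : integrable01 f -> I x ->
  integrable01 (fun y => k x y * f y).
Proof.
move=> intf; have mf := integrable01_measurable intf.
by apply: (integrable01_sectionx (G := fun x y => k x y * f y) (mkf mf) (kf_le f));
  exact/integrable01Z/integrable01_norm.
Qed.

Lemma integral_op_ae_eq f g x : measurable_fun I f -> measurable_fun I g ->
  f = g %[ae mu in I] -> I x -> L f x = L g x.
Proof.
move=> mf mg fg Ix; apply: ae_eq01_Rintegral.
- exact: (measurable_sectionx (G := fun x y => k x y * f y) (mkf mf)).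
- exact: (measurable_sectionx (G := fun x y => k x y * g y) (mkf mg)).
- by apply: filterS fg; [exact: (ae_filter_ringOfSetsType mu)|move=> y /= + Iy => ->].
Qed.

Lemma integral_opD f g x : integrable01 f -> integrable01 g -> I x ->
  L (fun y => f y + g y) x = L f x + L g x.
Proof.
move=> intf intg Ix; rewrite /integral_op -RintegralD//; try exact: integrable_kernelM.
by apply: eq_Rintegral => y _; rewrite mulrDr.
Qed.

Lemma integral_opB f g x : integrable01 f -> integrable01 g -> I x ->
  L (fun y => f y - g y) x = L f x - L g x.
Proof.
move=> intf intg Ix; rewrite /integral_op -RintegralB//; try exact: integrable_kernelM.
by apply: eq_Rintegral => y _; rewrite mulrBr.
Qed.

Lemma integral_opZ c f x : integrable01 f -> I x ->
  L (fun y => c * f y) x = c * L f x.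
Proof.
move=> intf Ix; rewrite /integral_op -RintegralZl//; last exact: integrable_kernelM.
by apply: eq_Rintegral => y _; rewrite mulrCA.
Qed.

Lemma integral_op_le f x : integrable01 f -> I x -> `|L f x| <= M * norm1 f.
Proof.
move=> intf Ix; apply: (le_trans (le_normr_Rintegral _ (integrable_kernelM intf Ix))) => //.
rewrite /norm1 -RintegralZl//; last exact: integrable01_norm.
apply: le_Rintegral => //.
- exact/integrable01_norm/integrable_kernelM.
- exact/integrable01Z/integrable01_norm.
- by move=> y Iy; exact: kf_le.
Qed.

Lemma integrable01_integral_op f : integrable01 f -> integrable01 (L f).
Proof.
move=> intf; have mf := integrable01_measurable intf.
by apply: (integrable01_Rintegral1 (G := fun x y => k x y * f y) (mkf mf) (kf_le f));
  exact/integrable01Z/integrable01_norm.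
Qed.

Lemma Rintegral_integral_op f : integrable01 f ->
  \int[mu]_(x in I) L f x = \int[mu]_(x in I) f x.
Proof.
move=> intf; have mf := integrable01_measurable intf.
rewrite /integral_op (Rintegral01_fubini (G := fun x y => k x y * f y) (mkf mf) (kf_le f)); last first.
  exact/integrable01Z/integrable01_norm.
apply: eq_Rintegral => y /set_mem Iy.
rewrite RintegralZr//; first by case: kP => _ _ ->; rewrite ?mul1r.
by apply: (bounded_integrable01 (B := M)) => [|x Ix]; [exact: (measurable_sectiony mk)|exact: kM].
Qed.

(** Positivity of [k] gives [|L f| <= L |f|], and [L] preserves the integral of [|f|]. *)
Lemma norm1_integral_op f : integrable01 f -> norm1 (L f) <= norm1 f.
Proof.
move=> intf; have intnf := integrable01_norm intf.
rewrite /norm1 -[leRHS](Rintegral_integral_op intnf); apply: le_Rintegral => //.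
- exact/integrable01_norm/integrable01_integral_op.
- exact: integrable01_integral_op.
move=> x Ix; apply: (le_trans (le_normr_Rintegral _ (integrable_kernelM intf Ix))) => //.
apply: le_Rintegral => //.
- exact/integrable01_norm/integrable_kernelM.
- exact: integrable_kernelM.
- by move=> y Iy; rewrite normrM ger0_norm// k0.
Qed.

Lemma integral_op_lipschitz K f x x' :
  (forall x x' y, I x -> I x' -> I y -> `|k x y - k x' y| <= K * `|x - x'|) ->
  integrable01 f -> I x -> I x' -> `|L f x - L f x'| <= K * `|x - x'| * norm1 f.
Proof.
move=> kK intf Ix Ix'; rewrite /integral_op -RintegralB//; try exact: integrable_kernelM.
have ikB := integrable01B (integrable_kernelM intf Ix) (integrable_kernelM intf Ix').
apply: (le_trans (le_normr_Rintegral _ ikB)) => //.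
rewrite /norm1 -RintegralZl//; last exact: integrable01_norm.
apply: le_Rintegral => //.
- exact: integrable01_norm.
- exact/integrable01Z/integrable01_norm.
- by move=> y Iy; rewrite -mulrBl normrM ler_wpM2r// kK.
Qed.

Section iterates.
Implicit Types (f g : R -> R) (n : nat).

Lemma integrable01_iter_integral_op n f : integrable01 f -> integrable01 (iter n L f).
Proof. by elim: n => //= n IH /IH; exact: integrable01_integral_op. Qed.

Lemma Rintegral_iter_integral_op n f : integrable01 f ->
  \int[mu]_(x in I) iter n L f x = \int[mu]_(x in I) f x.
Proof.
move=> intf; elim: n => //= n <-; apply: Rintegral_integral_op.
exact: integrable01_iter_integral_op.
Qed.

Lemma norm1_iter_integral_op n f : integrable01 f -> norm1 (iter n L f) <= norm1 f.
Proof.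
move=> intf; elim: n => //= n; apply: le_trans; apply: norm1_integral_op.
exact: integrable01_iter_integral_op.
Qed.

(** The first [n] applications do not increase the L^1 norm, and the last one passes from L^1 to the
    sup norm. *)
Lemma iterS_integral_op_le n f x : integrable01 f -> I x -> `|iter n.+1 L f x| <= M * norm1 f.
Proof.
move=> intf Ix; apply: le_trans (integral_op_le (integrable01_iter_integral_op n intf) Ix) _.
by rewrite ler_wpM2l// norm1_iter_integral_op.
Qed.

(** A bound uniform in [n]: [1] accounts for [n = 0], where nothing is smoothed, and [M] for all
    later iterates. *)
Lemma iter_integral_op_le n f B x : measurable_fun I f -> (forall y, I y -> `|f y| <= B) ->
  I x -> `|iter n L f x| <= (1 + M) * B.
Proof.
move=> mf fB Ix; have B0 : 0 <= B by exact: le_trans (fB 0 I01_0).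
case: n => [|n]; first by rewrite (le_trans (fB x Ix))// ler_peMl// lerDl.
rewrite (le_trans (iterS_integral_op_le n (bounded_integrable01 mf fB) Ix))//.
by rewrite ler_pM ?norm1_ge0// ?lerDr// norm1_le.
Qed.

Lemma iter_integral_opD n f g x : integrable01 f -> integrable01 g -> I x ->
  iter n L (fun y => f y + g y) x = iter n L f x + iter n L g x.
Proof.
move=> intf intg; elim: n x => //= n IH x Ix.
rewrite -integral_opD//; try exact: integrable01_iter_integral_op.
exact: integral_op_eq_in.
Qed.

Lemma iter_integral_opZ n c f x : integrable01 f -> I x ->
  iter n L (fun y => c * f y) x = c * iter n L f x.
Proof.
move=> intf; elim: n x => //= n IH x Ix.
rewrite -integral_opZ//; last exact: integrable01_iter_integral_op.
exact: integral_op_eq_in.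
Qed.

Lemma integrable01_sum m (f : nat -> R -> R) : (forall j, integrable01 (f j)) ->
  integrable01 (fun y => \sum_(j < m) f j y).
Proof.
move=> intf; elim: m => [|m IH].
  by under [X in EFin \o X]funext do rewrite big_ord0; exact: integrable01_cst.
under [X in EFin \o X]funext do rewrite big_ord_recr/=.
exact: integrable01D.
Qed.

Lemma Rintegral01_sum m (f : nat -> R -> R) : (forall j, integrable01 (f j)) ->
  \int[mu]_(x in I) (\sum_(j < m) f j x) = \sum_(j < m) \int[mu]_(x in I) f j x.
Proof.
move=> intf; elim: m => [|m IH].
  under eq_Rintegral do rewrite big_ord0.
  by rewrite big_ord0 Rintegral01_cst.
under eq_Rintegral do rewrite big_ord_recr/=.
by rewrite RintegralD ?big_ord_recr/= ?IH//; exact: integrable01_sum.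
Qed.

Lemma iter_integral_op_sum n m (f : nat -> R -> R) x : (forall j, integrable01 (f j)) -> I x ->
  iter n L (fun y => \sum_(j < m) f j y) x = \sum_(j < m) iter n L (f j) x.
Proof.
move=> intf Ix; elim: m => [|m IH].
  (* The empty sum is written as [0] times [f 0], so that homogeneity shows that its image
     vanishes. *)
  rewrite big_ord0 (_ : (fun _ => _) = (fun y => 0 * f 0%N y)); last first.
    by apply/funext => y; rewrite big_ord0 mul0r.
  by rewrite iter_integral_opZ// mul0r.
rewrite big_ord_recr/= -IH -iter_integral_opD//; last exact: integrable01_sum.
by apply: iter_integral_op_eq_in => // y _; rewrite big_ord_recr.
Qed.

End iterates.
End stochastic_kernel.

(** * Geometric estimates for real sequences *)

Section real_lemmas.
Context {R : realType}.
Implicit Types (K t : R) (u : R^nat).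

Lemma Bernoulli_ge t n : 0 <= t <= 1 -> 1 - n%:R * t <= (1 - t) ^+ n.
Proof.
move=> /andP[t0 t1]; elim: n => [|n IH]; first by rewrite mul0r subr0 expr0.
have t1' : 0 <= 1 - t by rewrite subr_ge0.
rewrite exprS; apply: le_trans (ler_wpM2l t1' IH).
have : 0 <= n%:R * (t * t) by rewrite !mulr_ge0.
by rewrite -natr1; lra.
Qed.

Lemma geometric_increments u K t : 0 <= t < 1 ->
  (forall n, `|u n.+1 - u n| <= K * t ^+ n) ->
  u @ \oo --> limn u /\ forall n, `|limn u - u n| <= K / (1 - t) * t ^+ n.
Proof.
move=> /andP[t0 t1] uK.
have t1' : 0 < 1 - t by rewrite subr_gt0.
have K0 : 0 <= K by have := le_trans (normr_ge0 _) (uK 0%N); rewrite expr0 mulr1.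
(* Keeping the exact partial geometric sum, and not only its bound by [t ^+ n], lets the induction
   on [p] close. *)
have step n p : `|u (n + p)%N - u n| <= K / (1 - t) * (t ^+ n - t ^+ (n + p)).
  elim: p => [|p IH]; first by rewrite addn0 !subrr normr0 mulr0.
  rewrite addnS (_ : _ - _ = (u (n + p).+1 - u (n + p)%N) + (u (n + p)%N - u n)); last by ring.
  apply: (le_trans (ler_normD _ _)); apply: (le_trans (lerD (uK _) IH)).
  rewrite le_eqVlt; apply/orP; left; apply/eqP; rewrite exprS; field.
  by rewrite gt_eqF.
have stepW n p : `|u (n + p)%N - u n| <= K / (1 - t) * t ^+ n.
  apply: (le_trans (step n p)); rewrite ler_wpM2l//; first by rewrite divr_ge0// ltW.
  by rewrite gerBl exprn_ge0.
have tailz : K / (1 - t) * t ^+ n @[n --> \oo] --> (0 : R).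
  by apply: cvg_geometric; rewrite ger0_norm.
have cu : cvg (u @ \oo).
  apply/cauchy_cvgP/cauchy_exP => e e0.
  have /cvgrPdist_lt/(_ _ e0)[n _ /(_ n (leqnn n))] := tailz.
  rewrite /= sub0r normrN ger0_norm; last by rewrite mulr_ge0 ?exprn_ge0// divr_ge0// ltW.
  move=> ne; exists (u n); exists n => // m /= nm.
  rewrite -ball_normE /= distrC -(subnKC nm).
  exact: le_lt_trans (stepW n _) ne.
split => // n; have h : `|u (n + p)%N - u n| @[p --> \oo] --> `|limn u - u n|.
  apply: cvg_norm; apply: cvgB; last exact: cvg_cst.
  by rewrite (_ : (fun p => _) = (fun p => u (p + n)%N)) ?cvg_shiftn//; apply/funext => p; rewrite addnC.
by apply: (ler_cvg_to h (cvg_cst _)); apply: nearW => p; exact: stepW.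
Qed.

End real_lemmas.

(** * Neumann series of contracting operators *)

Section contracting.
Context {R : realType}.
Local Notation mu := (@lebesgue_measure R).
Local Notation I := (I01 R).
Local Notation integrable01 f := (mu.-integrable I (EFin \o f)).
#[local] Hint Extern 0 (measurable (I01 _)) => solve [exact: measurable_I01] : core.
Implicit Types (f g : R -> R) (B : R).

Definition bounded_mean0 B g :=
  [/\ measurable_fun I g, forall x, I x -> `|g x| <= B & \int[mu]_(x in I) g x = 0].

Lemma bounded_mean0_integrable B g : bounded_mean0 B g -> integrable01 g.
Proof. by move=> [mg gB _]; exact: bounded_integrable01 mg gB. Qed.

Lemma bounded_mean0_ge0 B g : bounded_mean0 B g -> 0 <= B.
Proof. by move=> [_ gB _]; exact: le_trans (gB 0 I01_0). Qed.

Definition contracts (q : R) N (k : R -> R -> R) := forall g B,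
  bounded_mean0 B g ->
  forall x, I x -> `|iter N.+1 (integral_op k) g x| <= q * B.

(** The value [3 / 4] is what remains of the factor [1 / 2] of the unperturbed kernel after an error
    of at most [1 / 4] from the perturbation, so that the notion applies to both kernels. *)
Definition contracting (k : R -> R -> R) := exists N, contracts (3 / 4) N k.

(** The series for [(Id - L)^-1 g], summed pointwise so as to give a function rather than a class.
    It is used on bounded mean-zero [g], where it converges uniformly. *)
Definition neumann (k : R -> R -> R) g : R -> R := fun x =>
  limn (fun n : nat => \sum_(j < n) iter j (integral_op k) g x).

Context (k : R -> R -> R) (M : R).
Hypothesis kP : stochastic_kernel k M.
Local Notation L := (integral_op k).

Lemma bounded_mean0_iter n B B' g : bounded_mean0 B g ->
  (forall x, I x -> `|iter n L g x| <= B') -> bounded_mean0 B' (iter n L g).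
Proof.
move=> gB gB'; have intg := bounded_mean0_integrable gB; split => //.
  by apply: integrable01_measurable; exact: (integrable01_iter_integral_op kP).
by rewrite (Rintegral_iter_integral_op kP)//; case: gB.
Qed.

Hypothesis ck : contracting k.

(** Strong induction on [n] in blocks of [N.+1] iterates: each block multiplies the sup norm by at
    most [3 / 4], and iterates preserve mean zero, so the next block may be treated likewise. *)
Lemma contracting_decay : exists C t : R, [/\ 0 <= C, 0 <= t < 1 &
  forall n g B, bounded_mean0 B g ->
    forall x, I x -> `|iter n L g x| <= C * B * t ^+ n].
Proof.
have [N hN] := ck.
(* The rate is chosen by the Bernoulli inequality: [N.+1%:R * a = 1 / 4] gives [3 / 4 <= t ^+ N.+1],
   with no root to extract. *)
pose a : R := (4 * N.+1%:R)^-1; pose t := 1 - a.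
have N0 : (0 : R) < N.+1%:R by [].
have a0 : 0 < a by rewrite invr_gt0 mulr_gt0.
have a1 : a <= 1.
  by rewrite invf_le1 ?mulr_gt0// -[leLHS]mulr1 ler_pM// ler1n.
have t1 : 0 <= t < 1 by rewrite /t subr_ge0 a1 ltrBlDr ltrDl a0.
have /andP[t0 tlt1] := t1.
have tN : 3 / 4 <= t ^+ N.+1.
  apply: le_trans (Bernoulli_ge _ _); last by rewrite (ltW a0) a1.
  have -> : N.+1%:R * a = 4^-1 by rewrite /a; field; rewrite gt_eqF.
  lra.
have M0 := stochastic_kernel_ge0 kP.
(* For [n < N.+1] the bound [(1 + M) * B] is all there is; the factor [4 / 3] compensates [t ^+ n],
   which is at least [3 / 4] there. *)
exists (4 / 3 * (1 + M)), t; split => //; first by rewrite !mulr_ge0 ?addr_ge0.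
elim/ltn_ind => n IH g B gB x Ix; have B0 := bounded_mean0_ge0 gB.
have [nN|Nn] := ltnP n N.+1.
  have [mg gB' _] := gB.
  apply: (le_trans (iter_integral_op_le kP n mg gB' Ix)).
  have tn : 3 / 4 <= t ^+ n.
    by apply: (le_trans tN); rewrite ler_wiXn2l// ?(ltW tlt1)// ltnW.
  have MB : 0 <= (1 + M) * B by rewrite mulr_ge0// addr_ge0.
  have := ler_wpM2l MB tn; lra.
rewrite -(subnK Nn) iterD.
have gN := bounded_mean0_iter gB (hN g B gB).
have ltn : (n - N.+1 < n)%N by rewrite ltn_subrL (leq_trans _ Nn).
apply: (le_trans (IH _ ltn _ _ gN _ Ix)).
have X0 : 0 <= 4 / 3 * (1 + M) * B * t ^+ (n - N.+1).
  by rewrite mulr_ge0 ?exprn_ge0// mulr_ge0// mulr_ge0// addr_ge0.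
by rewrite exprD; have := ler_wpM2l X0 tN; lra.
Qed.

(** The partial sums have mean zero, satisfy [L (s n) = s n.+1 - g], and approach their limit
    uniformly at rate [t ^+ n]. Hence the mean of the limit and the residual of the equation are
    bounded by multiples of [t ^+ n] for every [n], and [small] makes them vanish. *)
Lemma neumann_solves : exists C : R, 0 <= C /\ forall g B, bounded_mean0 B g ->
  bounded_mean0 (C * B) (neumann k g) /\ forall x, I x -> neumann k g x - L (neumann k g) x = g x.
Proof.
have [C [t [C0 t1 decay]]] := contracting_decay.
have /andP[t0 tlt1] := t1.
have M0 := stochastic_kernel_ge0 kP.
exists (C / (1 - t)); split; first by rewrite divr_ge0// subr_ge0 ltW.
move=> g B gB; have intg := bounded_mean0_integrable gB.
pose s n x := \sum_(j < n) iter j L g x.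
have incr x n : I x -> `|s n.+1 x - s n x| <= C * B * t ^+ n.
  by move=> Ix; rewrite /s big_ord_recr/= addrAC subrr add0r; exact: decay.
have cvs x : I x -> s ^~ x @ \oo --> neumann k g x /\
    forall n, `|neumann k g x - s n x| <= C * B / (1 - t) * t ^+ n.
  by move=> Ix; exact: (geometric_increments t1 (incr x ^~ Ix)).
have intj j : integrable01 (iter j L g) by exact: (integrable01_iter_integral_op kP).
have ints n : integrable01 (s n) by exact: integrable01_sum.
have mn : measurable_fun I (neumann k g).
  apply: (measurable_fun_cvg (h := s)) => [n|x Ix]; last exact: (cvs x Ix).1.
  exact: integrable01_measurable.
have nB x : I x -> `|neumann k g x| <= C / (1 - t) * B.
  move=> Ix; have := (cvs x Ix).2 0%N; rewrite /s big_ord0 subr0 expr0 mulr1.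
  by rewrite mulrAC.
have intn : integrable01 (neumann k g) by exact: bounded_integrable01 mn nB.
have tailz c : c * t ^+ n @[n --> \oo] --> (0 : R).
  by apply: cvg_geometric; rewrite ger0_norm.
have small (x c : R) : (forall n, `|x| <= c * t ^+ n) -> x = 0.
  move=> h; apply/eqP; rewrite -normr_le0.
  by apply: (ler_cvg_to (cvg_cst _) (tailz c)); exact: nearW.
have int0 n : \int[mu]_(x in I) s n x = 0.
  rewrite (@Rintegral01_sum _ _ (fun j => iter j L g))// big1// => j _.
  by rewrite (Rintegral_iter_integral_op kP)//; case: gB.
split; [split => //|].
  apply: (small _ (C * B / (1 - t))) => n; rewrite -[X in `|X|]subr0 -(int0 n) -RintegralB//.
  apply: le_trans (le_normr_Rintegral _ _) _ => //; first exact: integrable01B.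
  apply: norm1_le => [|x Ix]; last exact: (cvs x Ix).2.
  by apply: integrable01_measurable; exact: integrable01B.
move=> x Ix; apply/eqP; rewrite -subr_eq0; apply/eqP.
apply: (small _ (C * B / (1 - t) * (1 + M))) => n.
have Ls : L (s n) x = s n.+1 x - g x.
  rewrite -[L (s n)]/(iter 1 L (s n)) (iter_integral_op_sum kP)//.
  by rewrite /s big_ord_recl/= addrAC subrr add0r.
have -> : neumann k g x - L (neumann k g) x - g x =
    (neumann k g x - s n.+1 x) - L (fun y => neumann k g y - s n y) x.
  by rewrite (integral_opB kP)// Ls; ring.
apply: (le_trans (ler_normB _ _)).
rewrite mulrDr mulr1 mulrDl; apply: lerD.
  apply: (le_trans ((cvs x Ix).2 _)); rewrite ler_wpM2l//.
    by rewrite divr_ge0 ?subr_ge0 ?(ltW tlt1)// mulr_ge0// (bounded_mean0_ge0 gB).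
  by rewrite exprS ler_piMl ?exprn_ge0// ltW.
apply: (le_trans (integral_op_le kP (integrable01B intn (ints n)) Ix)).
rewrite -mulrA mulrCA ler_wpM2l//; apply: norm1_le => [|y Iy]; last exact: (cvs y Iy).2.
by apply: integrable01_measurable; exact: integrable01B.
Qed.

(** Being equal to [L g], a fixed point is bounded by [M * norm1 g]. The geometric decay then
    applies to it, while its iterates do not move. *)
Lemma contracting_unique g : integrable01 g -> \int[mu]_(x in I) g x = 0 ->
  (forall x, I x -> L g x = g x) -> forall x, I x -> g x = 0.
Proof.
move=> intg g0 Lg x Ix; have [C [t [C0 t1 decay]]] := contracting_decay.
have /andP[t0 tlt1] := t1.
have gB : bounded_mean0 (M * norm1 g) g.
  split => //; first exact: integrable01_measurable.
  by move=> y Iy; rewrite -Lg// (integral_op_le kP).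
have iterg n y : I y -> iter n L g y = g y.
  elim: n y => //= n IH y Iy; rewrite -[RHS]Lg//.
  exact: integral_op_eq_in.
apply/eqP; rewrite -normr_le0.
have tailz : C * (M * norm1 g) * t ^+ n @[n --> \oo] --> (0 : R).
  by apply: cvg_geometric; rewrite ger0_norm.
apply: (ler_cvg_to (cvg_cst _) tailz); apply: nearW => n.
by rewrite -(iterg n)//; exact: decay.
Qed.

(** By uniqueness [g] coincides with the Neumann series of [w], so a bound on [w] controls a [g]
    that was only integrable, with a constant depending on [k] alone. *)
Lemma contracting_stable : exists C : R, 0 <= C /\ forall g w B,
  integrable01 g -> \int[mu]_(x in I) g x = 0 -> bounded_mean0 B w ->
  (forall x, I x -> g x - L g x = w x) -> forall x, I x -> `|g x| <= C * B.
Proof.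
have [C [C0 hC]] := neumann_solves; exists C; split => // g w B intg g0 wB gw x Ix.
have [nB nw] := hC _ _ wB; have intn := bounded_mean0_integrable nB.
have [_ nle n0] := nB.
suff -> : g x = neumann k w x by exact: nle.
apply/eqP; rewrite -subr_eq0; apply/eqP.
apply: (contracting_unique (g := fun x => g x - neumann k w x)) => //.
- exact: integrable01B.
- by rewrite RintegralB// g0 n0 subr0.
- move=> y Iy; rewrite (integral_opB kP)//.
  have := gw y Iy; have := nw y Iy; lra.
Qed.

(** Correction of the constant [1]: the function [1 + h] is invariant exactly when
    [h - L h = L 1 - 1], and this right-hand side is bounded with mean zero. *)
Lemma contracting_density : exists f B, [/\ measurable_fun I f,
  forall x, I x -> `|f x| <= B, forall x, I x -> L f x = f x &
  \int[mu]_(x in I) f x = 1].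
Proof.
have [C [C0 hC]] := neumann_solves.
have M0 := stochastic_kernel_ge0 kP.
pose one : R -> R := fun=> 1; have int1 : integrable01 one by exact: integrable01_cst.
pose g x := L one x - one x.
have intL1 : integrable01 (L one) by exact: (integrable01_integral_op kP).
have intg : integrable01 g by exact: integrable01B.
have gB : bounded_mean0 (M + 1) g.
  split; first exact: integrable01_measurable.
    move=> x Ix; apply: (le_trans (ler_normB _ _)); rewrite normr1 lerD2r.
    apply: (le_trans (integral_op_le kP int1 Ix)).
    rewrite ler_piMr//; apply: norm1_le => [|y _]; last by rewrite normr1.
    exact: measurable_cst.
  by rewrite RintegralB// (Rintegral_integral_op kP)// subrr.
have [nB ng] := hC _ _ gB; have intn := bounded_mean0_integrable nB.
have [_ nle n0] := nB.
have intf : integrable01 (fun x => one x + neumann k g x) by exact: integrable01D.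
exists (fun x => one x + neumann k g x), (1 + C * (M + 1)); split.
- exact: integrable01_measurable.
- move=> x Ix; apply: (le_trans (ler_normD _ _)); rewrite normr1 lerD2l.
  exact: nle.
- move=> x Ix; rewrite (integral_opD kP)//; have := ng x Ix; rewrite /g; lra.
- by rewrite RintegralD// n0 addr0 Rintegral01_cst.
Qed.

(** The difference [d] is fixed only almost everywhere. Since [L] ignores null sets, [L d] is fixed
    at every point, so [contracting_unique] applies to [L d]. *)
Lemma contracting_density_unique f g : integrable01 f -> integrable01 g ->
  L f = f %[ae mu in I] -> L g = g %[ae mu in I] ->
  \int[mu]_(x in I) f x = \int[mu]_(x in I) g x -> f = g %[ae mu in I].
Proof.
move=> intf intg Lf Lg fg; pose d x := f x - g x.
have intd : integrable01 d by exact: integrable01B.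
have intLd : integrable01 (L d) by exact: (integrable01_integral_op kP).
have Ld : L d = d %[ae mu in I].
  apply: filterS2 Lf Lg; first exact: (ae_filter_ringOfSetsType mu).
  by move=> x /= fx gx Ix; rewrite (integral_opB kP)// fx// gx.
have Ld0 x : I x -> L d x = 0.
  apply: (contracting_unique intLd).
    by rewrite (Rintegral_integral_op kP)// RintegralB// fg subrr.
  by move=> y Iy; apply: (integral_op_ae_eq kP) => //; exact: integrable01_measurable.
apply: filterS Ld; first exact: (ae_filter_ringOfSetsType mu).
by move=> x /= h Ix; apply/eqP; rewrite -subr_eq0 -/(d x) -h// Ld0.
Qed.

End contracting.

(** * From mixing to contraction *)

Section mixing_contracts.
Context {R : realType}.
Local Notation mu := (@lebesgue_measure R).
Local Notation I := (I01 R).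
Local Notation integrable01 f := (mu.-integrable I (EFin \o f)).
#[local] Hint Extern 0 (measurable (I01 _)) => solve [exact: measurable_I01] : core.

Definition cell (m j : nat) : R -> R := \1_(`[j%:R / m%:R, j.+1%:R / m%:R[%classic).

Lemma measurable_cell m j : measurable_fun I (cell m j).
Proof. by apply: measurable_funTS; exact: measurable_indic. Qed.

Lemma cell_norm_le m j x : `|cell m j x| <= 1.
Proof. by rewrite /cell indicE; case: (_ \in _); rewrite ?normr1// normr0. Qed.

Lemma integrable01_cell m j : integrable01 (cell m j).
Proof.
apply: (bounded_integrable01 (B := 1)) => [|x _]; last exact: cell_norm_le.
exact: measurable_cell.
Qed.

(** The index is the integer part of [x * m%:R]. The point [x = 1] falls in the cell [j = m], hence
    [m.+1] cells. *)
Lemma sum_cell m (u : nat -> R) x : (0 < m)%N -> I x ->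
  exists j : nat, [/\ (j <= m)%N, \sum_(i < m.+1) u i * cell m i x = u j &
    0 <= x - j%:R / m%:R <= m%:R^-1].
Proof.
move=> m0 /I01P/andP[x0 x1]; have m0' : 0 < m%:R :> R by rewrite ltr0n.
have xm0 : 0 <= x * m%:R by rewrite mulr_ge0.
have /andP[jx xj] := truncn_itv xm0.
set j := Num.truncn _ in jx xj; exists j.
have jm : (j <= m)%N.
  by rewrite -(ler_nat R) (le_trans jx)// ler_piMl.
split => //; last first.
  rewrite subr_ge0 ler_pdivrMr// jx lerBlDr -[X in X + _]mul1r -mulrDl.
  by rewrite ler_pdivlMr// addrC natr1 ltW.
rewrite (bigD1 (Ordinal (jm : (j < m.+1)%N)))//= big1 ?addr0; last first.
  move=> i ij; rewrite /cell indicE memNset ?mulr0//= in_itv/=.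
  rewrite ler_pdivrMr// ltr_pdivlMr// => /andP[ix xi].
  have ij1 : (i < j.+1)%N by rewrite -(ltr_nat R); exact: le_lt_trans ix xj.
  have ji1 : (j < i.+1)%N by rewrite -(ltr_nat R); exact: le_lt_trans jx xi.
  by move/eqP : ij; apply; apply/val_inj/eqP; rewrite /= eqn_leq -ltnS ij1 -ltnS.
rewrite /cell indicE mem_set ?mulr1//= in_itv/=.
by rewrite ler_pdivrMr// ltr_pdivlMr// jx xj.
Qed.

(* [L g] is [K B]-Lipschitz, hence uniformly close to a combination of the
   finitely many centered indicators [e j] of a fixed grid; mixing provides an
   iterate that is small on all of them at once. *)
Lemma mixing_contracts (k : R -> R -> R) (M K : R) : stochastic_kernel k M ->
  (forall x x' y, I x -> I x' -> I y -> `|k x y - k x' y| <= K * `|x - x'|) ->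
  (forall g B, bounded_mean0 B g ->
    norm1 (iter n (integral_op k) g) @[n --> \oo] --> (0 : R)) ->
  exists N, contracts (1 / 2) N k.
Proof.
move=> kP kK kmix; set L := integral_op k.
have M0 := stochastic_kernel_ge0 kP.
have I1 : I 1 by apply/I01P; rewrite ler01 lexx.
have K0 : 0 <= K.
  have := le_trans (normr_ge0 _) (kK 1 0 0 I1 I01_0 I01_0).
  by rewrite subr0 normr1 mulr1.
(* Any [m] above [8 * M * K] will do. The target [1 / 2] is shared equally: [1 / 4] for the grid
   error, [1 / 4] for the finitely many [e j]. *)
have [m m0 mP] : exists2 m, (0 < m)%N & M * (2 * K) / m%:R <= 1 / 4.
  exists (Num.bound (8 * M * K)).+1 => //.
  have b0 : 0 < (Num.bound (8 * M * K)).+1%:R :> R by [].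
  rewrite ler_pdivrMr//.
  have b1 : 8 * M * K < (Num.bound (8 * M * K))%:R.
    by apply: archi_boundP; rewrite !mulr_ge0.
  by rewrite -natr1; lra.
pose c j := \int[mu]_(x in I) cell m j x.
pose e j x := cell m j x - c j.
have inte j : integrable01 (e j).
  by apply: integrable01B; [exact: integrable01_cell|exact: integrable01_cst].
have eB j : bounded_mean0 (1 + `|c j|) (e j).
  split; first exact: integrable01_measurable.
    by move=> x _; rewrite (le_trans (ler_normB _ _))// lerD2r cell_norm_le.
  rewrite RintegralB//; [|exact: integrable01_cell|exact: integrable01_cst].
  by rewrite Rintegral01_cst subrr.
have sum0 i : \sum_(j < i) norm1 (iter n L (e j)) @[n --> \oo] --> (0 : R).
  elim: i => [|i IH].
    by under eq_fun do rewrite big_ord0; exact: cvg_cst.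
  under eq_fun do rewrite big_ord_recr/=.
  have h := cvgD IH (kmix _ _ (eB i)).
  rewrite addr0 in h.
  exact: h.
have sumz : M * M * \sum_(j < m.+1) norm1 (iter n L (e j)) @[n --> \oo] --> (0 : R).
  have h := cvgMl_tmp (a := M * M) (sum0 m.+1).
  rewrite mulr0 in h.
  exact: h.
have q0 : (0 : R) < 1 / 4 by lra.
have /cvgrPdist_le/(_ _ q0)[n _ /(_ n (leqnn n))] := sumz.
rewrite /= sub0r normrN ger0_norm; last first.
  by rewrite mulr_ge0 ?mulr_ge0// sumr_ge0// => j _; exact: norm1_ge0.
move=> nP; exists n.+1 => g B gB x Ix.
have intg := bounded_mean0_integrable gB; have B0 := bounded_mean0_ge0 gB.
have [mg gle g0] := gB.
have ng : norm1 g <= B by exact: norm1_le.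
pose h := L g.
have inth : integrable01 h by exact: (integrable01_integral_op kP).
have hM y : I y -> `|h y| <= M * B.
  move=> Iy; apply: (le_trans (integral_op_le kP intg Iy)).
  by rewrite ler_wpM2l.
have hlip y y' : I y -> I y' -> `|h y - h y'| <= K * B * `|y - y'|.
  move=> Iy Iy'; apply: (le_trans (integral_op_lipschitz kP kK intg Iy Iy')).
  by rewrite mulrAC ler_wpM2r// ler_wpM2l.
have m0' : 0 < m%:R :> R by rewrite ltr0n.
have jmI j : (j <= m)%N -> I (j%:R / m%:R).
  move=> jm; apply/I01P; rewrite divr_ge0//= ler_pdivrMr// mul1r ler_nat//.
pose u j := h (j%:R / m%:R).
pose hc y := \sum_(j < m.+1) u j * cell m j y.
have hcle y : I y -> `|h y - hc y| <= K * B / m%:R.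
  move=> Iy; have [j [jm]] := sum_cell u m0 Iy; rewrite -/(hc y) => -> /andP[yj0 yj1].
  apply: (le_trans (hlip _ _ Iy (jmI _ jm))); rewrite ler_wpM2l ?mulr_ge0//.
  by rewrite ger0_norm.
have inthc : integrable01 hc.
  by apply: (@integrable01_sum _ _ (fun j y => u j * cell m j y)) => j; apply: integrable01Z; exact: integrable01_cell.
(* Centering the cells subtracts from [hc] its mean. As [h] has mean zero, that mean is no larger
   than the grid error, whence the factor [2] in [rle]. *)
pose p y := \sum_(j < m.+1) u j * e j y.
have intp : integrable01 p by apply: (@integrable01_sum _ _ (fun j y => u j * e j y)) => j; exact: integrable01Z.
have pE y : p y = hc y - \int[mu]_(z in I) hc z.
  have -> : \int[mu]_(z in I) hc z = \sum_(j < m.+1) u j * c j.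
    rewrite (@Rintegral01_sum _ _ (fun j y => u j * cell m j y)) => [|j].
      by apply: eq_bigr => j _; rewrite RintegralZl//; exact: integrable01_cell.
    by apply: integrable01Z; exact: integrable01_cell.
  by rewrite /p /hc -sumrB; apply: eq_bigr => j _; rewrite mulrBr.
have inthB : integrable01 (fun y => h y - hc y) by exact: integrable01B.
have hcint : `|\int[mu]_(z in I) hc z| <= K * B / m%:R.
  have -> : \int[mu]_(z in I) hc z = - \int[mu]_(z in I) (h z - hc z).
    by rewrite RintegralB// (Rintegral_integral_op kP)// g0 sub0r opprK.
  rewrite normrN; apply: (le_trans (le_normr_Rintegral _ inthB)) => //.
  by apply: norm1_le => //; exact: integrable01_measurable.
have intr : integrable01 (fun y => h y - p y) by exact: integrable01B.
have rle : norm1 (fun y => h y - p y) <= 2 * K / m%:R * B.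
  apply: norm1_le => [|y Iy]; first exact: integrable01_measurable.
  rewrite pE opprB addrCA addrC.
  apply: (le_trans (ler_normD _ _)).
  have -> : 2 * K / m%:R * B = K * B / m%:R + K * B / m%:R by ring.
  by apply: lerD => //; exact: hcle.
(* One application of [L] has been spent on the regularity of [h]. Of the other [n.+1], the last one
   turns L^1 bounds into pointwise ones. *)
have -> : iter n.+2 L g x = iter n.+1 L (fun y => p y + (h y - p y)) x.
  rewrite -[LHS]/(iter n.+2 L g x) iterSr; apply: iter_integral_op_eq_in => // y _.
  by rewrite addrC subrK.
rewrite (iter_integral_opD kP)//; apply: (le_trans (ler_normD _ _)).
have -> : 1 / 2 * B = 1 / 4 * B + 1 / 4 * B by field.
apply: lerD; last first.
  apply: (le_trans (iterS_integral_op_le kP n intr Ix)).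
  apply: (le_trans (ler_wpM2l M0 rle)).
  by have := ler_wpM2r B0 mP; lra.
rewrite (@iter_integral_op_sum _ _ _ kP _ _ (fun j y => u j * e j y)) => [|j|//]; last exact: integrable01Z.
apply: (le_trans (ler_norm_sum _ _ _)).
(* Each coefficient is a value of [h], hence at most [M * B]; this makes the choice of [n]
   independent of [g]. *)
apply: (@le_trans _ _ (\sum_(j < m.+1) M * B * (M * norm1 (iter n L (e j))))).
  apply: ler_sum => j _; rewrite (iter_integral_opZ kP)// normrM ler_pM//.
    by apply: hM; apply: jmI; rewrite -ltnS.
  exact: (integral_op_le kP (integrable01_iter_integral_op kP n (inte j)) Ix).
rewrite -!mulr_sumr; have := ler_wpM2r B0 nP; lra.
Qed.

End mixing_contracts.

(** * Perturbation of the kernel *)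

Section perturbation.
Context {R : realType}.
Local Notation mu := (@lebesgue_measure R).
Local Notation I := (I01 R).
Local Notation integrable01 f := (mu.-integrable I (EFin \o f)).
#[local] Hint Extern 0 (measurable (I01 _)) => solve [exact: measurable_I01] : core.

(** The improvement [b |-> e + b / 2] has fixed point [2 * e], and iterating it forgets the initial
    bound. Some finite [b0] must start the iteration, but its size leaves no trace. *)
Lemma le_of_half_bound (T : Type) (P : set T) (g : T -> R) (b0 e : R) :
  (forall x, P x -> `|g x| <= b0) ->
  (forall b, (forall x, P x -> `|g x| <= b) -> forall x, P x -> `|g x| <= e + b / 2) ->
  forall x, P x -> `|g x| <= 2 * e.
Proof.
move=> gb0 ge x Px.
have gn n : forall x, P x -> `|g x| <= 2 * e + (b0 - 2 * e) * (1 / 2) ^+ n.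
  elim: n => [|n IH] y Py; first by rewrite expr0 mulr1 subrKC gb0.
  apply: (le_trans (ge _ IH y Py)); rewrite exprS; lra.
have half : `|1 / 2 : R| < 1 by rewrite ger0_norm; lra.
have cz : 2 * e + (b0 - 2 * e) * (1 / 2) ^+ n @[n --> \oo] --> 2 * e + (0 : R).
  by apply: cvgD; [exact: cvg_cst|exact: cvg_geometric].
rewrite addr0 in cz.
by apply: (ler_cvg_to (cvg_cst _) cz); apply: nearW => n; exact: gn.
Qed.

Implicit Types (f g w : R -> R) (B b : R) (n : nat).
Variables (k k' : R -> R -> R) (M : R) (E : R -> R).
Hypothesis kP : stochastic_kernel k M.
Hypothesis k'P : stochastic_kernel k' M.
Hypothesis intE : integrable01 E.
Hypothesis kE : forall x y, I x -> I y -> `|k' x y - k x y| <= E y.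
Local Notation L := (integral_op k).
Local Notation L' := (integral_op k').
Local Notation eps := (\int[mu]_(y in I) E y).

Lemma integral_op_perturb f B x : measurable_fun I f ->
  (forall y, I y -> `|f y| <= B) -> I x -> `|L' f x - L f x| <= eps * B.
Proof.
move=> mf fB Ix; have intf := bounded_integrable01 mf fB.
have int1 := integrable_kernelM k'P intf Ix; have int2 := integrable_kernelM kP intf Ix.
rewrite /integral_op -RintegralB//.
apply: (le_trans (le_normr_Rintegral _ (integrable01B int1 int2))) => //.
rewrite -RintegralZr//; apply: le_Rintegral => //.
- exact/integrable01_norm/integrable01B.
- by under [X in EFin \o X]funext do rewrite mulrC; exact: integrable01Z.
by move=> y Iy; rewrite -mulrBl normrM ler_pM// ?kE ?fB.
Qed.

(** The recursion comes from splitting the difference of the [n.+1]-st iterates as [L'] applied to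
    the difference of the [n]-th ones (factor [M]) plus [L' - L] applied to the [n]-th iterate of
    [L] (bounded by [(1 + M) * B]). *)
Fixpoint perturb_const (n : nat) : R :=
  if n is m.+1 then M * perturb_const m + (1 + M) else 0.

Let M0 := stochastic_kernel_ge0 kP.

Lemma perturb_const_ge0 n : 0 <= perturb_const n.
Proof. by elim: n => //= n IH; rewrite addr_ge0 ?mulr_ge0 ?addr_ge0. Qed.

Lemma iter_integral_op_perturb n f B : measurable_fun I f ->
  (forall y, I y -> `|f y| <= B) -> forall x, I x ->
  `|iter n L' f x - iter n L f x| <= perturb_const n * (eps * B).
Proof.
move=> mf fB; have intf := bounded_integrable01 mf fB.
elim: n => [|n IH] x Ix /=; first by rewrite subrr normr0 mul0r.
have i1 := integrable01_iter_integral_op k'P n intf.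
have i2 := integrable01_iter_integral_op kP n intf.
have -> : L' (iter n L' f) x - L (iter n L f) x =
    L' (fun y => iter n L' f y - iter n L f y) x +
    (L' (iter n L f) x - L (iter n L f) x).
  by rewrite (integral_opB k'P)// addrA subrK.
apply: (le_trans (ler_normD _ _)).
have i12 := integrable01B i1 i2.
have h1 := integral_op_le k'P i12 Ix.
have h2 : norm1 (fun y => iter n L' f y - iter n L f y) <= perturb_const n * (eps * B).
  by apply: norm1_le => //; exact: integrable01_measurable.
have h3 := integral_op_perturb (integrable01_measurable i2)
  (fun y Iy => iter_integral_op_le kP n mf fB Iy) Ix.
have := ler_wpM2l M0 h2; lra.
Qed.

Lemma contracts_perturb N : contracts (1 / 2) N k ->
  perturb_const N.+1 * eps <= 1 / 4 -> contracts (3 / 4) N k'.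
Proof.
move=> kN small g B gB x Ix; have [mg gle _] := gB.
have h1 := kN g B gB x Ix.
have h2 := iter_integral_op_perturb N.+1 mg gle Ix.
have h3 := ler_wpM2r (bounded_mean0_ge0 gB) small.
have -> : iter N.+1 L' g x =
  (iter N.+1 L' g x - iter N.+1 L g x) + iter N.+1 L g x by rewrite subrK.
by apply: (le_trans (ler_normD _ _)); lra.
Qed.

Lemma bounded_mean0_perturb f B : measurable_fun I f ->
  (forall y, I y -> `|f y| <= B) ->
  bounded_mean0 (eps * B) (fun x => L' f x - L f x).
Proof.
move=> mf fB; have intf := bounded_integrable01 mf fB.
have i1 := integrable01_integral_op k'P intf.
have i2 := integrable01_integral_op kP intf.
split; first by apply: integrable01_measurable; exact: integrable01B.
- by move=> x Ix; exact: integral_op_perturb.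
- by rewrite RintegralB// (Rintegral_integral_op k'P)// (Rintegral_integral_op kP)// subrr.
Qed.

(** If [|f' - f| <= b], then [|f'| <= B + b], and stability applied to
    [(Id - L) (f' - f) = (L' - L) f'] gives [C * eps * (B + b)], at most [C * eps * B + b / 2]. Thus
    [B'], which is not controlled uniformly, only starts the bootstrap. *)
Lemma density_perturb (C : R) f f' B B' : 0 <= C ->
  (forall g w b, integrable01 g -> \int[mu]_(x in I) g x = 0 -> bounded_mean0 b w ->
    (forall x, I x -> g x - L g x = w x) -> forall x, I x -> `|g x| <= C * b) ->
  C * eps <= 1 / 2 ->
  measurable_fun I f -> measurable_fun I f' ->
  (forall x, I x -> `|f x| <= B) -> (forall x, I x -> `|f' x| <= B') ->
  (forall x, I x -> L f x = f x) -> (forall x, I x -> L' f' x = f' x) ->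
  \int[mu]_(x in I) f x = \int[mu]_(x in I) f' x ->
  forall x, I x -> `|f' x - f x| <= 2 * (C * eps * B).
Proof.
move=> C0 stable small mf mf' fB f'B Lf Lf' ff'.
have intf := bounded_integrable01 mf fB; have intf' := bounded_integrable01 mf' f'B.
apply: (le_of_half_bound (b0 := B' + B)).
  by move=> x Ix; rewrite (le_trans (ler_normB _ _))// lerD ?fB ?f'B.
move=> b hb x Ix.
have f'le y : I y -> `|f' y| <= B + b.
  move=> Iy; rewrite -(subrK (f y) (f' y)) addrC.
  by rewrite (le_trans (ler_normD _ _))// lerD ?fB ?hb.
have b0 : 0 <= b by exact: le_trans (hb 0 I01_0).
have := stable (fun y => f' y - f y) _ _ (integrable01B intf' intf) _
  (bounded_mean0_perturb mf' f'le).
rewrite RintegralB// ff' subrr => /(_ erefl) h.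
apply: (le_trans (h _ x Ix)).
  move=> y Iy; rewrite (integral_opB kP)// Lf' ?Lf//; ring.
by have := ler_wpM2r b0 small; lra.
Qed.

End perturbation.

(** * Invariant densities and the inverse on V *)

Section mean_zero.
Context {R : realType}.
Local Notation mu := (@lebesgue_measure R).
Local Notation I := (I01 R).
Local Notation integrable01 f := (mu.-integrable I (EFin \o f)).
#[local] Hint Extern 0 (measurable (I01 _)) => solve [exact: measurable_I01] : core.
Implicit Types (f g h : R -> R) (B : R).

Lemma V_integrable f : V f -> integrable01 f.
Proof. by move=> [L2f _]; have [] := norm1_le_norm2 L2f. Qed.

Lemma V_measurable f : V f -> measurable_fun I f.
Proof. by move=> [/L2_measurable]. Qed.

Lemma bounded_mean0_V B f : bounded_mean0 B f -> V f.
Proof. by move=> [mf fB f0]; split => //; exact: bounded_L2 mf fB. Qed.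

Lemma bounded_mean0N B f : bounded_mean0 B f -> bounded_mean0 B (fun x => - f x).
Proof.
move=> fB; have intf := bounded_mean0_integrable fB; have [mf fle f0] := fB; split.
- exact: measurableT_comp.
- by move=> x Ix; rewrite normrN fle.
- under eq_Rintegral do rewrite -mulN1r.
  by rewrite RintegralZl// f0 mulr0.
Qed.

Lemma V_add f g : V f -> V g -> V (fun x => f x + g x).
Proof.
move=> Vf Vg; have mf := V_measurable Vf; have mg := V_measurable Vg.
have intf := V_integrable Vf; have intg := V_integrable Vg.
have [L2f f0] := Vf; have [L2g g0] := Vg; split.
  apply/L2P; split; first exact: measurable_funD.
  apply: (le_lt_trans (norm2D mf mg)).
  by rewrite lte_add_pinfty ?ltey_eq ?norm2_fin_num.
by rewrite RintegralD// f0 g0 addr0.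
Qed.

Lemma V_ae f g : V f -> measurable_fun I g -> f = g %[ae mu in I] -> V g.
Proof.
move=> Vf mg fg; have mf := V_measurable Vf; have [L2f f0] := Vf; split.
  by apply/L2P; split => //; rewrite -(ae_eq_norm2 mf mg fg); have /L2P[] := L2f.
by rewrite -(ae_eq01_Rintegral mf mg fg).
Qed.

Lemma eq_in_ae f g : (forall x, I x -> f x = g x) -> f = g %[ae mu in I].
Proof. by move=> fg; apply: aeW => x Ix; exact: fg. Qed.

Context (k : R -> R -> R) (M : R).
Hypothesis kP : stochastic_kernel k M.
Local Notation L := (integral_op k).

Lemma integral_op_bounded_mean0 f : integrable01 f -> \int[mu]_(x in I) f x = 0 ->
  bounded_mean0 (M * norm1 f) (L f).
Proof.
move=> intf f0; split.
- by apply: integrable01_measurable; exact: (integrable01_integral_op kP).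
- by move=> x; exact: (integral_op_le kP).
- by rewrite (Rintegral_integral_op kP).
Qed.

(** Replacing [f] by [L f] changes it on a null set only, which [L] does not see: the equation now
    holds at every point. *)
Lemma invariant_density_regular f : invariant_density L f ->
  [/\ measurable_fun I (L f), forall x, I x -> `|L f x| <= M * norm1 f,
      forall x, I x -> L (L f) x = L f x, \int[mu]_(x in I) L f x = 1 &
      L f = f %[ae mu in I]].
Proof.
move=> [L2f Lf f1]; have [intf _] := norm1_le_norm2 L2f.
have intLf := integrable01_integral_op kP intf; split => //.
- exact: integrable01_measurable.
- by move=> x; exact: (integral_op_le kP).
- by move=> x Ix; apply: (integral_op_ae_eq kP) => //; exact: integrable01_measurable.
- by rewrite (Rintegral_integral_op kP).
Qed.

Hypothesis ck : contracting k.

Lemma invariant_density_unique : exists2 f, invariant_density L f &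
  forall g, invariant_density L g -> g = f %[ae mu in I].
Proof.
have [f [B [mf fB Lf f1]]] := contracting_density kP ck.
have intf := bounded_integrable01 mf fB.
exists f; first by split; [exact: bounded_L2 mf fB|exact: eq_in_ae|].
move=> g [L2g Lg g1]; have [intg _] := norm1_le_norm2 L2g.
apply: (contracting_density_unique kP ck) => //; first exact: eq_in_ae.
by rewrite g1.
Qed.

(** An element of [V] may be unbounded, so the Neumann series is not applied to it directly. It is
    applied to [L g], which is bounded, through the identity [(Id - L)^-1 = Id + (Id - L)^-1 L]. *)
Lemma contracting_bounded_inverse : exists S, bounded_inverse_on_V L S.
Proof.
have [C [C0 hC]] := neumann_solves kP ck.
have M0 := stochastic_kernel_ge0 kP.
pose S g x := g x + neumann k (L g) x.
have LB g : V g -> bounded_mean0 (M * norm1 g) (L g).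
  by move=> Vg; apply: integral_op_bounded_mean0; [exact: V_integrable|case: Vg].
have nB g : V g -> bounded_mean0 (C * (M * norm1 g)) (neumann k (L g)).
  by move=> Vg; have [] := hC _ _ (LB g Vg).
have VB g : V g -> V (g \- L g).
  move=> Vg; apply: V_add => //.
  exact: bounded_mean0_V (bounded_mean0N (LB g Vg)).
have VS g : V g -> V (S g).
  by move=> Vg; apply: V_add => //; exact: bounded_mean0_V (nB g Vg).
have Ssolve g x : V g -> I x -> S g x - L (S g) x = g x.
  move=> Vg Ix; have [_ /(_ x Ix)] := hC _ _ (LB g Vg).
  rewrite (integral_opD kP)//; [|exact: V_integrable|exact: bounded_mean0_integrable (nB g Vg)].
  by rewrite /S; lra.
exists S; split.
- by move=> g Vg; split; [exact: VB|exact: VS].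
- move=> g h Vg Vh gh.
  have Lgh y : I y -> L g y = L h y.
    by apply: (integral_op_ae_eq kP) => //; exact: V_measurable.
  apply: filterS gh; first exact: (ae_filter_ringOfSetsType mu).
  move=> x /= gh Ix; rewrite /S gh//; congr (_ + _); rewrite /neumann.
  rewrite (_ : (fun n => _) = fun n => \sum_(j < n) iter j L (L h) x)//.
  apply/funext => n; apply: eq_bigr => j _.
  exact: iter_integral_op_eq_in.
- by move=> g Vg; apply: eq_in_ae => x Ix; exact: Ssolve.
- move=> g Vg; apply: eq_in_ae => x Ix; apply/eqP; rewrite -subr_eq0; apply/eqP.
  have VSg := VS _ (VB g Vg).
  (* A right inverse is also a left inverse once [Id - L] is injective on mean-zero functions. *)
  apply: (contracting_unique kP ck (g := fun x => S (g \- L g) x - g x)) => //.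
  + by apply: integrable01B; exact: V_integrable.
  + rewrite RintegralB//; try exact: V_integrable.
    by case: VSg => _ ->; case: Vg => _ ->; rewrite subrr.
  + move=> y Iy; rewrite (integral_opB kP)//; try exact: V_integrable.
    by have := Ssolve _ y (VB g Vg) Iy; rewrite /=; lra.
- exists (1 + C * M) => g Vg; have [mn nle _] := nB g Vg.
  have [L2g _] := Vg; have [_ n12] := norm1_le_norm2 L2g.
  apply: (le_trans (norm2D (V_measurable Vg) mn)).
  rewrite EFinD ge0_muleDl ?mul1e ?lee_fin ?mulr_ge0// leeD2l//.
  apply: (le_trans (norm2_bounded mn nle)).
  rewrite -(fineK (norm2_fin_num L2g)) -EFinM lee_fin -mulrA.
  by rewrite !ler_wpM2l.
Qed.

End mean_zero.

(** * Folding *)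

Section folding.
Context {R : realType}.
Local Notation mu := (@lebesgue_measure R).
Local Notation I := (I01 R).
Local Notation integrable01 f := (mu.-integrable I (EFin \o f)).
#[local] Hint Extern 0 (measurable (I01 _)) => solve [exact: measurable_I01] : core.
Implicit Types (f g : R -> R) (b x : R).

Let c n (j : nat) : R := 2 * (j%:R - n%:R).

(* The n-th partial sum in [P_pi (tau (- b) f) x]; for [f] supported in [-1, 1]
   it does not depend on [n >= 2]. *)
Definition fold n f b x : R :=
  \sum_(j < n.*2.+1) (f (c n j + x - b) + f (c n j - x - b)).

(** Passing to [n.+1] shifts the index by one and adds the terms at the even integers [2 * (n + 1)]
    and [- 2 * (n + 1)]; their four arguments lie outside the support. *)
Lemma fold_step n f b x : (2 <= n)%N -> (forall u, u \notin `[-1, 1] -> f u = 0) ->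
  I b -> I x -> fold n.+1 f b x = fold n f b x.
Proof.
move=> n2 f0 /I01P/andP[b0 b1] /I01P/andP[x0 x1].
have n2' : 2 <= n%:R :> R by rewrite (ler_nat R 2).
rewrite /fold doubleS big_ord_recl/= big_ord_recr/=.
have cS (i : nat) : c n.+1 (bump 0 i) = c n i.
  by rewrite /c /bump/= add1n -(natr1 n) -(natr1 i); ring.
have cl : c n.+1 0 = - 2 * (n%:R + 1) by rewrite /c -(natr1 n); ring.
have cr : c n.+1 (bump 0 n.*2.+1) = 2 * (n%:R + 1).
  rewrite cS /c (_ : n.*2.+1%:R = n%:R + n%:R + 1); first by ring.
  by rewrite -natr1 -addnn natrD.
rewrite cl cr !f0 ?addr0 ?add0r; last 4 first.
- by rewrite in_itv/= negb_and -!ltNge; apply/orP; right; lra.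
- by rewrite in_itv/= negb_and -!ltNge; apply/orP; right; lra.
- by rewrite in_itv/= negb_and -!ltNge; apply/orP; left; lra.
- by rewrite in_itv/= negb_and -!ltNge; apply/orP; left; lra.
by apply: eq_bigr => i _; rewrite cS.
Qed.

Lemma P_piE f b x : (forall u, u \notin `[-1, 1] -> f u = 0) -> I b -> I x ->
  P_pi (tau (- b) f) x = fold 2 f b x.
Proof.
move=> f0 Ib Ix; rewrite /P_pi (_ : (fun n => _) = fun n => fold n f b x)//.
apply: lim_near_cst => //; exists 2%N => //= n /= n2.
rewrite -(subnKC n2); elim: (n - 2)%N => [|p IH]; first by rewrite addn0.
by rewrite addnS fold_step ?leq_addr.
Qed.

Lemma fold_sum_le n (F : nat -> R) B : (forall j, `|F j| <= B) ->
  `|\sum_(j < n.*2.+1) F j| <= n.*2.+1%:R * B.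
Proof.
move=> FB; apply: (le_trans (ler_norm_sum _ _ _)).
by rewrite -[X in X%:R]card_ord mulr_natl -sumr_const; apply: ler_sum.
Qed.

(** The [10] of all later estimates counts the values of [f] in [fold 2]: five even translates, two
    signs of [x]. *)
Lemma fold_norm_le f B b x : (forall u, `|f u| <= B) -> `|fold 2 f b x| <= 10 * B.
Proof.
move=> fB; have := @fold_sum_le 2 (fun j => f (c 2 j + x - b) + f (c 2 j - x - b)) (B + B).
have -> : (2.*2.+1)%:R * (B + B) = 10 * B :> R by rewrite -[(2.*2.+1)%N]/5%N; ring.
by apply => j; rewrite (le_trans (ler_normD _ _))// lerD.
Qed.

Lemma fold_lipschitz f K b b' x x' : (forall u v, `|f u - f v| <= K * `|u - v|) ->
  `|fold 2 f b x - fold 2 f b' x'| <= 10 * (K * (`|b - b'| + `|x - x'|)).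
Proof.
move=> fK; rewrite /fold -sumrB.
set D := K * _.
have := @fold_sum_le 2 (fun j => f (c 2 j + x - b) + f (c 2 j - x - b) -
  (f (c 2 j + x' - b') + f (c 2 j - x' - b'))) (D + D).
have -> : (2.*2.+1)%:R * (D + D) = 10 * D :> R by rewrite -[(2.*2.+1)%N]/5%N; ring.
have K0 : 0 <= K by have := le_trans (normr_ge0 _) (fK 1 0); rewrite subr0 normr1 mulr1.
apply => j; rewrite opprD addrACA (le_trans (ler_normD _ _))// lerD//.
  apply: (le_trans (fK _ _)); rewrite ler_wpM2l//.
  rewrite (_ : _ - _ = (b' - b) + (x - x')); last by ring.
  by rewrite (distrC b) ler_normD.
apply: (le_trans (fK _ _)); rewrite ler_wpM2l//.
rewrite (_ : _ - _ = (b' - b) - (x - x')); last by ring.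
by rewrite (distrC b) ler_normB.
Qed.

Lemma measurable_fold d (X : measurableType d) (D : set X) f (b x : X -> R) :
  measurable_fun setT f -> measurable_fun D b -> measurable_fun D x ->
  measurable_fun D (fun z => fold 2 f (b z) (x z)).
Proof.
move=> mf mb mx; apply: measurable_sum => j.
apply: measurable_funD; apply: (measurableT_comp mf); apply: measurable_funB => //.
- exact: measurable_funD.
- exact: measurable_funB.
Qed.

Lemma Rintegral01_derive F f : (forall x, is_derive x 1 F (f x)) -> continuous f ->
  \int[mu]_(x in I) f x = F 1 - F 0.
Proof.
move=> dF cf; rewrite /Rintegral (@continuous_FTC2 _ f F 0 1) ?ltr01//.
- exact: continuous_subspaceT.
- have cF : continuous F.
    move=> x; apply: differentiable_continuous; apply/derivable1_diffP.
    exact: (@ex_derive _ _ _ _ _ _ _ (dF x)).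
  split.
  + by move=> x _; exact: (@ex_derive _ _ _ _ _ _ _ (dF x)).
  + exact/cvg_at_right_filter/cF.
  + exact/cvg_at_left_filter/cF.
- by move=> x _; rewrite derive1E; exact: (@derive_val _ _ _ _ _ _ _ (dF x)).
Qed.

(** For each even integer [c] the two terms together integrate [f] over the interval from
    [c - 1 - b] to [c + 1 - b]. These intervals tile [[-5 - b, 5 - b]], which contains the support,
    so the sum of increments of the primitive [F] telescopes. *)
Lemma Rintegral01_fold f b : continuous f -> mu.-integrable setT (EFin \o f) ->
  (forall u, u \notin `[-1, 1] -> f u = 0) -> -1 <= b <= 2 ->
  \int[mu]_(x in I) fold 2 f b x = \int[mu]_x f x.
Proof.
move=> cf intf f0 /andP[b1 b2].
pose F t := \int[mu]_(u in `]-oo, t]) f u.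
have dF (t : R) : is_derive t (1 : R) F (f t).
  have t1 : t < t + 1 by rewrite ltrDl.
  have intt : mu.-integrable [set` `]-oo, t + 1]] (EFin \o f) by exact: integrableS intf.
  have [dt <-] := @continuous_FTC1 _ f -oo%O t (t + 1) t1 intt (ltNyr t) (cf t).
  by rewrite derive1E; exact: DeriveDef.
have cfa (a : R) : continuous (fun x => f (a + x - b)).
  move=> x; apply: (@continuous_comp _ _ _ (fun x => a + x - b) f); last exact: cf.
  by apply: cvgB; [apply: cvgD; [exact: cvg_cst|exact: cvg_id]|exact: cvg_cst].
have cfb (a : R) : continuous (fun x => f (a - x - b)).
  move=> x; apply: (@continuous_comp _ _ _ (fun x => a - x - b) f); last exact: cf.
  by apply: cvgB; [apply: cvgB; [exact: cvg_cst|exact: cvg_id]|exact: cvg_cst].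
have ci g : continuous g -> integrable01 g.
  move=> cg; apply: continuous_compact_integrable; first exact: segment_compact.
  exact: continuous_subspaceT.
have dp (a x : R) : is_derive x (1 : R) (fun x => a + x - b) 1.
  by apply: is_derive_eq; rewrite add0r subr0.
have dm (a x : R) : is_derive x (1 : R) (fun x => a - x - b) (- 1).
  by apply: is_derive_eq; rewrite subr0 add0r mul1r.
have E1 a : \int[mu]_(x in I) f (a + x - b) = F (a + 1 - b) - F (a - b).
  have d (x : R) : is_derive x (1 : R) (fun x => F (a + x - b)) (f (a + x - b)).
    rewrite -[f _]mulr1.
    have h := @is_derive1_comp R F (fun x => a + x - b) x _ _ (dF (a + x - b)) (dp a x).
    exact: h.
  by rewrite (Rintegral01_derive d (cfa a)) addr0.
have E2 a : \int[mu]_(x in I) f (a - x - b) = F (a - b) - F (a - 1 - b).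
  have d (x : R) : is_derive x (1 : R) (fun x => - F (a - x - b)) (f (a - x - b)).
    rewrite (_ : f _ = - (f (a - x - b) * - 1)); last by rewrite mulrN1 opprK.
    have h := @is_derive1_comp R F (fun x => a - x - b) x _ _ (dF (a - x - b)) (dm a x).
    have h' := is_deriveN h.
    exact: h'.
  by rewrite (Rintegral01_derive d (cfb a)) subr0 opprK addrC.
under eq_Rintegral do rewrite /fold.
rewrite (@Rintegral01_sum _ _ (fun j x => f (c 2 j + x - b) + f (c 2 j - x - b))); last first.
  by move=> j; apply: integrable01D; exact: ci.
pose G j := F (c 2 j - 1 - b).
have FE (j : nat) :
    \int[mu]_(x in I) (f (c 2 j + x - b) + f (c 2 j - x - b)) = G j.+1 - G j.
  rewrite RintegralD//; [|exact: ci|exact: ci].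
  rewrite E1 E2 /G (_ : c 2 j.+1 - 1 - b = c 2 j + 1 - b); first by ring.
  by rewrite /c -(natr1 j); ring.
rewrite (eq_bigr _ (fun (j : 'I_5) _ => FE j)) -(big_mkord xpredT (fun j => G j.+1 - G j)).
rewrite telescope_sumr// /G.
have -> : F (c 2 0 - 1 - b) = 0.
  rewrite /F (_ : \int[mu]_(x in _) f x = \int[mu]_(x in `]-oo, (c 2 0 - 1 - b)%R]) (cst 0 x)).
    by rewrite /Rintegral integral0.
  apply: eq_Rintegral => u; rewrite inE/= in_itv/= => uc; apply: f0.
  rewrite in_itv/= negb_and -!ltNge; apply/orP; left.
  by apply: (le_lt_trans uc); rewrite /c; lra.
rewrite subr0 /F Rintegral_mkcond; apply: eq_Rintegral => u _.
rewrite patchE; case: ifPn => //; rewrite notin_setE/= in_itv/= => /negP uc.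
rewrite f0//= in_itv/= negb_and -!ltNge; apply/orP; right.
by move: uc; rewrite -ltNge; apply: lt_trans; rewrite /c; lra.
Qed.

End folding.

(** * Difference quotients of the folded noise density *)

Section folding_derivative.
Context {R : realType}.
Local Notation mu := (@lebesgue_measure R).
Local Notation I := (I01 R).
Local Notation integrable01 f := (mu.-integrable I (EFin \o f)).
#[local] Hint Extern 0 (measurable (I01 _)) => solve [exact: measurable_I01] : core.
Implicit Types (f g : R -> R) (b x : R).

Lemma dominated_cvg01 (u : nat -> R -> R) (v h : R -> R) :
  (forall n, measurable_fun I (u n)) -> measurable_fun I v ->
  {ae mu, forall x, I x -> u n x @[n --> \oo] --> v x} -> integrable01 h ->
  (forall n x, I x -> `|u n x| <= h x) ->
  \int[mu]_(x in I) u n x @[n --> \oo] --> \int[mu]_(x in I) v x.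
Proof.
move=> mun mv uv inth uh.
have [||||||intv _ cv] := @dominated_convergence _ _ _ mu I _
    (fun n => EFin \o u n) (EFin \o v) (EFin \o h).
- exact: measurable_I01.
- by move=> n; apply/measurable_EFinP; exact: mun.
- by apply/measurable_EFinP; exact: mv.
- apply: filterS uv; first exact: (ae_filter_ringOfSetsType mu).
  by move=> x /= uvx Ix; apply: cvg_EFin => //; [exact: nearW|exact: uvx].
- exact: inth.
- by apply: aeW => x n Ix /=; rewrite lee_fin uh.
apply: fine_cvg; rewrite /Rintegral fineK//.
exact: integrable_fin_num.
Qed.

(** Undoes an affine substitution [g] with inverse [h]. *)
Lemma derivable_shift f g h x :
  (forall u, g (h u) = u) -> h (g x) = x -> derivable h (g x) 1 ->
  derivable (f \o g) x 1 -> derivable f (g x) 1.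
Proof.
move=> gh hg dh dfg; rewrite (_ : f = (f \o g) \o h); last first.
  by apply/funext => u /=; rewrite gh.
apply/derivable1_diffP; apply: differentiable_comp; first exact/derivable1_diffP.
by rewrite hg; exact/derivable1_diffP.
Qed.

Context (rho : R -> R) (K : R).
Hypothesis K0 : 0 < K.
Hypothesis rhoK : forall u v, `|rho u - rho v| <= K * `|u - v|.
Local Notation drho := (rho^`())%classic.

Lemma lipschitz_continuous : continuous rho.
Proof.
move=> x; apply/cvgrPdist_le => e e0; near=> y.
apply: (le_trans (rhoK _ _)); rewrite -ler_pdivlMl// mulrC.
near: y; exists (e / K); first exact: divr_gt0.
by move=> y /= /ltW.
Unshelve. all: by end_near. Qed.

(** Rademacher is applied to each map sending [x] to one argument of [rho] and then to [rho], so
    that no null set has to be transported by an affine map. The interval []-1, 2[] leaves room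
    around both endpoints of [[0, 1]]. The exceptional set depends on [b]. *)
Lemma ae_derivable_fold b : {ae mu, forall x, I x -> forall j : nat,
  derivable rho (2 * (j%:R - 2%:R) + x - b) 1 /\
  derivable rho (2 * (j%:R - 2%:R) - x - b) 1}.
Proof.
have I12 x : I x -> -1 < x < 2 by move=> /I01P/andP[x0 x1]; apply/andP; split; lra.
have ltN12 : (-1 : R) < 2 by lra.
have : {ae mu, forall x, forall j : nat, I x ->
  derivable rho (2 * (j%:R - 2%:R) + x - b) 1 /\
  derivable rho (2 * (j%:R - 2%:R) - x - b) 1}.
  apply: ae_foralln => j; set a := 2 * _.
  have L1 x y : `|(rho \o (fun x => a + x - b)) x - (rho \o (fun x => a + x - b)) y| <= K * `|x - y|.
    apply: (le_trans (rhoK _ _)); rewrite /= (_ : a + x - b - _ = x - y)//; ring.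
  have L2 x y : `|(rho \o (fun x => a - x - b)) x - (rho \o (fun x => a - x - b)) y| <= K * `|x - y|.
    apply: (le_trans (rhoK _ _)); rewrite /= (_ : a - x - b - _ = y - x); last by ring.
    by rewrite distrC.
  have := lipschitz_ae_derivable_itv K0 ltN12 L2.
  have := lipschitz_ae_derivable_itv K0 ltN12 L1.
  apply: filterS2; first exact: (ae_filter_ringOfSetsType mu).
  move=> x d1 d2 Ix; split.
    apply: (derivable_shift (h := fun u => u - a + b) _ _ _ (d1 (I12 x Ix))).
    - by move=> u; ring.
    - by ring.
    - by apply: derivableD; [exact: derivableB|exact: derivable_cst].
  apply: (derivable_shift (h := fun u => a - u - b) _ _ _ (d2 (I12 x Ix))).
  - by move=> u; ring.
  - by ring.
  - by apply: derivableB; [exact: derivableB|exact: derivable_cst].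
apply: filterS; first exact: (ae_filter_ringOfSetsType mu).
by move=> x h Ix j; exact: h.
Qed.

Lemma cvg_fold_derive b x (s : nat -> R) :
  (forall n, s n != 0) -> s @ \oo --> 0 ->
  (forall j : nat, derivable rho (2 * (j%:R - 2%:R) + x - b) 1 /\
     derivable rho (2 * (j%:R - 2%:R) - x - b) 1) ->
  (fold 2 rho (b + s n) x - fold 2 rho b x) / s n @[n --> \oo] --> - fold 2 drho b x.
Proof.
move=> s0 cs dx.
have Ns0 n : - s n != 0 by rewrite oppr_eq0.
have cNs : (fun n => - s n) @ \oo --> 0 by rewrite -oppr0; exact: cvgN.
have cpt p : derivable rho p 1 -> (rho (p - s n) - rho p) / s n @[n --> \oo] --> - drho p.
  move=> dp.
  rewrite (_ : (fun n => (rho (p - s n) - rho p) / s n) =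
    (fun n => - ((- s n)^-1 * (rho (- s n + p) - rho p)))).
    by apply: cvgN; exact: (cvg_derive1 Ns0 cNs dp).
  by apply/funext => n; rewrite invrN mulNr opprK [- s n + p]addrC mulrC.
pose p (j : nat) := 2 * (j%:R - 2%:R) + x - b.
pose q (j : nat) := 2 * (j%:R - 2%:R) - x - b.
have key m : \sum_(j < m) ((rho (p j - s n) - rho (p j)) / s n +
      (rho (q j - s n) - rho (q j)) / s n) @[n --> \oo] -->
    - \sum_(j < m) (drho (p j) + drho (q j)).
  elim: m => [|i IH].
    under eq_fun do rewrite big_ord0.
    by rewrite big_ord0 oppr0; exact: cvg_cst.
  under eq_fun do rewrite big_ord_recr/=.
  rewrite big_ord_recr/= opprD; apply: cvgD; first exact: IH.
  by rewrite opprD; apply: cvgD; apply: cpt; have [] := dx i.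
rewrite (_ : (fun n => _) = (fun n => \sum_(j < 2.*2.+1) ((rho (p j - s n) - rho (p j)) / s n +
      (rho (q j - s n) - rho (q j)) / s n))); first exact: key.
apply/funext => n; rewrite /fold -sumrB mulr_suml; apply: eq_bigr => j _.
by rewrite -mulrDl addrACA -opprD /p /q !opprD !addrA.
Qed.

Lemma drho_le u : `|drho u| <= K.
Proof. by apply: derive1_norm_le => //; exact: ltW. Qed.

Lemma measurable_drho : measurable_fun setT drho.
Proof. by apply: measurable_derive1; exact: lipschitz_continuous. Qed.

Lemma measurable_rho : measurable_fun setT rho.
Proof. by apply: continuous_measurable_fun; exact: lipschitz_continuous. Qed.

(* The error in the difference quotient of [b |-> P_pi (tau (- b) rho) x] in the
   direction [v], with the a.e. derivative of [rho] in the linear term. *)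
Definition remainder b v d x : R :=
  (fold 2 rho (b + d * v) x - fold 2 rho b x) / d + v * fold 2 drho b x.

(** Quotient and linear term contribute [10 * K * |v|] each. The bound needs no differentiability at
    the points involved, so it serves as majorant in [x] and then in [y]. *)
Lemma remainder_le b v d x : 0 < d -> `|remainder b v d x| <= 20 * K * `|v|.
Proof.
move=> d0; rewrite /remainder; apply: (le_trans (ler_normD _ _)).
have -> : 20 * K * `|v| = 10 * (K * `|v|) + `|v| * (10 * K) by ring.
apply: lerD; last by rewrite normrM ler_wpM2l// fold_norm_le//; exact: drho_le.
rewrite normrM normfV (gtr0_norm d0) ler_pdivrMr//.
apply: (le_trans (fold_lipschitz _ _ _ _ rhoK)).
by rewrite subrr normr0 addr0 addrC addKr normrM (gtr0_norm d0); lra.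
Qed.

Lemma measurable_remainder d (X : measurableType d) (D : set X) (b v x : X -> R) (e : R) :
  measurable_fun D b -> measurable_fun D v -> measurable_fun D x ->
  measurable_fun D (fun z => remainder (b z) (v z) e (x z)).
Proof.
move=> mb mv mx; apply: measurable_funD; apply: measurable_funM => //.
- apply: measurable_funB; apply: measurable_fold => //; try exact: measurable_rho.
  apply: measurable_funD => //; exact: measurable_funM.
- by apply: measurable_fold => //; exact: measurable_drho.
Qed.

Lemma cvg_Rintegral01_remainder b v (d : nat -> R) :
  (forall n, 0 < d n) -> d @ \oo --> 0 ->
  \int[mu]_(x in I) `|remainder b v (d n) x| @[n --> \oo] --> (0 : R).
Proof.
move=> d0 cd; rewrite -[X in _ --> X](Rintegral01_cst (0:R)).
apply: (@dominated_cvg01 _ _ (fun=> 20 * K * `|v|)).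
- move=> n; apply: measurableT_comp => //.
  by apply: measurable_remainder => //; exact: measurable_cst.
- exact: measurable_cst.
- apply: filterS (ae_derivable_fold b); first exact: (ae_filter_ringOfSetsType mu).
  move=> x dx Ix; rewrite -[X in _ --> X](normr0 R); apply: cvg_norm.
  (* The derivative is tested along the steps [d n * v], which must not vanish; for [v = 0] the
     remainder is identically [0]. *)
  have [->|v0] := eqVneq v 0.
    rewrite /remainder; under eq_fun do rewrite mulr0 addr0 subrr mul0r mul0r addr0.
    exact: cvg_cst.
  have s0 n : d n * v != 0 by rewrite mulf_neq0// gt_eqF.
  have cs : d n * v @[n --> \oo] --> (0 : R).
    by have h := cvgMr_tmp (b := v) cd; rewrite mul0r in h; exact: h.
  rewrite (_ : (fun n => _) = (fun n => v * ((fold 2 rho (b + d n * v) x -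
      fold 2 rho b x) / (d n * v)) + v * fold 2 drho b x)); last first.
    apply/funext => n; rewrite /remainder; congr (_ + _); field.
    by rewrite v0 gt_eqF.
  rewrite -[X in _ --> X](addNr (v * fold 2 drho b x)) -mulrN.
  apply: cvgD; last exact: cvg_cst.
  by apply: cvgMl_tmp; exact: cvg_fold_derive s0 cs (dx Ix).
- exact: integrable01_cst.
- by move=> n x Ix; rewrite normr_id remainder_le.
Qed.

End folding_derivative.

(** * Linear response of the noise kernel *)

Section noise_kernel.
Context {R : realType}.
Local Notation mu := (@lebesgue_measure R).
Local Notation I := (I01 R).
Local Notation integrable01 f := (mu.-integrable I (EFin \o f)).
#[local] Hint Extern 0 (measurable (I01 _)) => solve [exact: measurable_I01] : core.
Implicit Types (f g T : R -> R) (b x y B : R).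

Context (rho : R -> R) (K : R).
Hypothesis K0 : 0 < K.
Hypothesis rhoK : forall u v, `|rho u - rho v| <= K * `|u - v|.
Hypothesis rho_density : probability_density rho.
Hypothesis rho_supp : forall u, u \notin `[-1, 1] -> rho u = 0.
Local Notation drho := (rho^`())%classic.

(** Comparison with [rho 2 = 0], at distance at most [3] from any point of the support. With the ten
    values in [fold 2] this yields the kernel bound [10 * (3 * K)]. *)
Let rho_le u : `|rho u| <= 3 * K.
Proof.
have [|/rho_supp ->] := boolP (u \in `[-1, 1]); last by rewrite normr0 mulr_ge0// ltW.
rewrite in_itv/= => /andP[u1 u2].
have r2 : rho 2 = 0 by apply: rho_supp; rewrite in_itv/= negb_and -!ltNge; apply/orP; right; lra.
have := rhoK u 2; rewrite r2 subr0 => /le_trans; apply.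
rewrite [leRHS]mulrC; apply: ler_wpM2l; first exact: ltW.
by rewrite ler_norml; apply/andP; split; lra.
Qed.

Let rho_integrable : mu.-integrable setT (EFin \o rho).
Proof.
have [mrho rho0 rho1] := rho_density.
apply/integrableP; split; first exact/measurable_EFinP.
under eq_integral do rewrite /= ger0_norm//.
by rewrite rho1 ltry.
Qed.

Lemma Rintegral01_fold_density b : -1 <= b <= 2 ->
  \int[mu]_(x in I) fold 2 rho b x = 1.
Proof.
move=> b12; have [_ _ rho1] := rho_density.
rewrite Rintegral01_fold//; first by rewrite /Rintegral rho1.
exact: (lipschitz_continuous K0 rhoK).
Qed.

Lemma drho_supp u : u \notin `[-1, 1] -> drho u = 0.
Proof.
rewrite in_itv/= negb_and -!ltNge => u1.
rewrite derive1E (near_eq_derive (g := cst 0)) ?derive_cst//.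
case/orP : u1 => u1; near=> z; apply: rho_supp; rewrite in_itv/= negb_and -!ltNge;
  apply/orP; [left|right]; near: z.
- exact: lt_nbhsl.
- exact: lt_nbhsr.
Unshelve. all: by end_near. Qed.

(** The integral of [fold 2 rho b] is [1] for every [b], so its difference quotients in [b] have
    integral zero, and dominated convergence passes this to the derivative. The shifted parameters
    [b + s n] may reach [2], which explains the range of [b] in [Rintegral01_fold_density]. *)
Lemma Rintegral01_fold_drho b : I b -> \int[mu]_(x in I) fold 2 drho b x = 0.
Proof.
move=> Ib; have /I01P/andP[b0 b1] := Ib.
pose s (n : nat) : R := harmonic n.
have sgt0 n : 0 < s n by exact: harmonic_gt0.
have s0 n : s n != 0 by rewrite gt_eqF.
have s1 n : s n <= 1 by rewrite /s /harmonic invf_le1// ler1n.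
pose u n x := (fold 2 rho (b + s n) x - fold 2 rho b x) / s n.
have mfold f c : measurable_fun setT f -> measurable_fun I (fold 2 f c).
  by move=> mf; apply: measurable_fold => //; exact: measurable_cst.
have mrho := measurable_rho K0 rhoK; have mdrho := measurable_drho K0 rhoK.
have intrho c : integrable01 (fold 2 rho c).
  by apply: (bounded_integrable01 (B := 10 * (3 * K))) => [|x _]; [exact: mfold|exact: fold_norm_le].
have int0 n : \int[mu]_(x in I) u n x = 0.
  rewrite /u RintegralZr//; last exact: integrable01B.
  rewrite RintegralB// !Rintegral01_fold_density ?subrr ?mul0r//.
  - by apply/andP; split; lra.
  - by have := s1 n; have := sgt0 n => ? ?; apply/andP; split; lra.
have cu : \int[mu]_(x in I) u n x @[n --> \oo] --> \int[mu]_(x in I) - fold 2 drho b x.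
  apply: (@dominated_cvg01 _ _ _ (fun=> 10 * K)).
  - move=> n; apply: measurable_funM => //; apply: measurable_funB; exact: mfold.
  - by apply: measurableT_comp => //; exact: mfold.
  - apply: filterS (ae_derivable_fold K0 rhoK b); first exact: (ae_filter_ringOfSetsType mu).
    by move=> x dx Ix; apply: cvg_fold_derive (dx Ix) => //; exact: cvg_harmonic.
  - exact: integrable01_cst.
  - move=> n x Ix; rewrite /u normrM normfV ler_pdivrMr ?normr_gt0//.
    apply: (le_trans (fold_lipschitz _ _ _ _ rhoK)).
    by rewrite subrr normr0 addr0 addrC addKr mulrA.
have intd : integrable01 (fold 2 drho b).
  apply: (bounded_integrable01 (B := 10 * K)) => [|x _]; first exact: mfold.
  by apply: fold_norm_le; exact: drho_le.
have cu0 : \int[mu]_(x in I) u n x @[n --> \oo] --> (0 : R).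
  by under eq_fun do rewrite int0; exact: cvg_cst.
have E : \int[mu]_(x in I) - fold 2 drho b x = 0 :> R.
  by apply: (cvg_unique (@Rhausdorff R) cu cu0).
move: E; under eq_Rintegral do rewrite -mulN1r.
by rewrite RintegralZl// mulN1r => /eqP; rewrite oppr_eq0 => /eqP.
Qed.

Lemma noise_kernelE T x y : (forall y, I y -> I (T y)) -> I x -> I y ->
  noise_kernel rho T x y = fold 2 rho (T y) x.
Proof. by move=> TI Ix Iy; apply: P_piE => //; exact: TI. Qed.

Let mfoldT f T : measurable_fun setT f -> measurable_fun I T ->
  measurable_fun (I `*` I) (fun z : R * R => fold 2 f (T z.2) z.1).
Proof.
move=> mf mT; apply: measurable_fold => //.
- apply: (measurable_comp measurable_I01 _ mT).
    by move=> _ [[x y] [_ Iy] <-].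
  by apply: measurable_funTS; exact: measurable_snd.
- by apply: measurable_funTS; exact: measurable_fst.
Qed.

Lemma noise_kernel_stochastic T : measurable_fun I T -> (forall y, I y -> I (T y)) ->
  stochastic_kernel (noise_kernel rho T) (10 * (3 * K)).
Proof.
move=> mT TI; have [mrho rho0 _] := rho_density; split.
- apply: (eq_measurable_fun (fun z : R * R => fold 2 rho (T z.2) z.1)).
    by move=> [x y] /set_mem[/= Ix Iy]; rewrite noise_kernelE.
  exact: mfoldT.
- move=> x y Ix Iy; rewrite noise_kernelE//; apply/andP; split.
    by rewrite sumr_ge0// => j _; rewrite addr_ge0.
  by apply: le_trans (ler_norm _) _; exact: fold_norm_le.
- move=> y Iy; under eq_Rintegral => x /set_mem Ix do rewrite noise_kernelE//.
  have /I01P/andP[T0 T1] := TI y Iy.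
  by apply: Rintegral01_fold_density; apply/andP; split; lra.
Qed.

Lemma noise_kernel_lipschitz T x x' y : (forall y, I y -> I (T y)) ->
  I x -> I x' -> I y ->
  `|noise_kernel rho T x y - noise_kernel rho T x' y| <= 10 * K * `|x - x'|.
Proof.
move=> TI Ix Ix' Iy; rewrite !noise_kernelE//.
apply: (le_trans (fold_lipschitz _ _ _ _ rhoK)).
by rewrite subrr normr0 add0r mulrA.
Qed.

Lemma noise_kernel_perturb T T' x y : (forall y, I y -> I (T y)) ->
  (forall y, I y -> I (T' y)) -> I x -> I y ->
  `|noise_kernel rho T' x y - noise_kernel rho T x y| <= 10 * K * `|T' y - T y|.
Proof.
move=> TI T'I Ix Iy; rewrite !noise_kernelE//.
apply: (le_trans (fold_lipschitz _ _ _ _ rhoK)).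
by rewrite subrr normr0 addr0 mulrA.
Qed.

Section response.
Variables (T v : R -> R).
Hypothesis mT : measurable_fun I T.
Hypothesis TI : forall y, I y -> I (T y).
Hypothesis intv : integrable01 v.

Let mv : measurable_fun I v. Proof. exact: integrable01_measurable. Qed.
Let mdrho := measurable_drho K0 rhoK.
Let mrho := measurable_rho K0 rhoK.

Let mcomp2 f : measurable_fun I f -> measurable_fun (I `*` I) (fun z : R * R => f z.2).
Proof.
move=> mf; apply: (measurable_comp measurable_I01 _ mf).
  by move=> _ [[x y] [_ Iy] <-].
by apply: measurable_funTS; exact: measurable_snd.
Qed.

(** Square integrability follows from [integrable_square] applied to the square of the kernel,
    dominated by [(10 * K) ^+ 2 * v y ^+ 2]. The mean-zero condition, which comes from
    [Rintegral01_fold_drho], holds for every [y]. *)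
Lemma Vker_response : L2 v ->
  Vker (fun x y => - P_pi (tau (- T y) drho) x * v y).
Proof.
move=> L2v; pose G x y := - fold 2 drho (T y) x * v y.
have PE x y : I x -> I y -> - P_pi (tau (- T y) drho) x * v y = G x y.
  by move=> Ix Iy; rewrite P_piE//; [exact: drho_supp|exact: TI].
have mG : measurable_fun (I `*` I) (fun z : R * R => G z.1 z.2).
  apply: measurable_funM; last exact: mcomp2.
  by apply: measurableT_comp => //; exact: mfoldT.
have Gle x y : `|G x y| <= 10 * K * `|v y|.
  by rewrite normrM normrN ler_wpM2r// fold_norm_le// => u; exact: drho_le.
split.
- rewrite /L2_square (_ : _ \_ _ = (fun z : R * R => G z.1 z.2) \_ (I `*` I)); last first.
    apply/funext => -[x y]; rewrite !patchE; case: ifPn => // /set_mem[/= Ix Iy].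
    exact: PE.
  rewrite inE; apply/andP; split; rewrite inE/=.
    by rewrite -measurable_restrictT//; exact: measurableX.
  rewrite /finite_norm unlock poweR_lty//.
  have iv2 : integrable01 (fun y => (10 * K) ^+ 2 * v y ^+ 2).
    apply: integrable01Z; apply/integrableP; split.
      by apply/measurable_EFinP; exact: measurable_funX.
    under eq_integral do rewrite /= ger0_norm ?sqr_ge0//.
    by apply/norm2_ltyP; have /L2P[] := L2v.
  have mG2 : measurable_fun (I `*` I) (fun z : R * R => G z.1 z.2 ^+ 2).
    exact: measurable_funX.
  have G2le x y : I x -> I y -> `|G x y ^+ 2| <= (10 * K) ^+ 2 * v y ^+ 2.
    move=> _ _; rewrite ger0_norm ?sqr_ge0// -exprMn -real_normK ?num_real//.
    rewrite -[leRHS]real_normK ?num_real// lerXn2r ?nnegrE//.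
    by rewrite [leRHS]normrM [X in _ <= X * _]gtr0_norm ?mulr_gt0.
  have := integrable_square (G := fun x y => G x y ^+ 2) mG2 G2le iv2.
  move=> /integrable_lty => /(_ measurableT); congr (_ < _)%E.
  apply: eq_integral => z _ /=; rewrite !patchE; case: ifPn => _.
    by rewrite powR_mulrn// real_normK// num_real.
  by rewrite (_ : point = 0 :> R)// normr0 powR0 ?pnatr_eq0.
- apply: aeW => y Iy.
  transitivity (\int[mu]_(x in I) ((- v y) * fold 2 drho (T y) x)).
    by apply: eq_Rintegral => x /set_mem Ix; rewrite PE// /G mulrC mulrN mulNr.
  rewrite RintegralZl//; first by rewrite Rintegral01_fold_drho ?mulr0//; exact: TI.
  apply: (bounded_integrable01 (B := 10 * K)) => [|x _].
    by apply: measurable_fold => //; exact: measurable_cst.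
  by apply: fold_norm_le; exact: drho_le.
Qed.

Let absrem d x y := `|remainder rho (T y) (v y) d x|.

Let mabsrem d : measurable_fun (I `*` I) (fun z : R * R => absrem d z.1 z.2).
Proof.
apply: measurableT_comp => //; apply: (measurable_remainder K0 rhoK) => //.
- exact: mcomp2.
- exact: mcomp2.
- by apply: measurable_funTS; exact: measurable_fst.
Qed.

Let absrem_le d x y : 0 < d -> I x -> I y -> `|absrem d x y| <= 20 * K * `|v y|.
Proof. by move=> d0 _ _; rewrite normr_id (remainder_le K0 rhoK). Qed.

Let int_absrem : integrable01 (fun y => 20 * K * `|v y|).
Proof. by apply: integrable01Z; exact: integrable01_norm. Qed.

Lemma integrable01_remainder d : 0 < d ->
  integrable01 (fun x => \int[mu]_(y in I) `|remainder rho (T y) (v y) d x|).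
Proof. by move=> d0; exact: (integrable01_Rintegral1 (mabsrem d) (fun x y => absrem_le d0) int_absrem). Qed.

Lemma Rintegral_remainder_le d x : 0 < d -> I x ->
  \int[mu]_(y in I) `|remainder rho (T y) (v y) d x| <= 20 * K * norm1 v.
Proof.
move=> d0 Ix; rewrite /norm1 -RintegralZl//; last exact: integrable01_norm.
apply: le_Rintegral => //.
  exact: (integrable01_sectionx (mabsrem d) (fun x y => absrem_le d0) int_absrem Ix).
by move=> y Iy; exact: (remainder_le K0 rhoK).
Qed.

(** If [T] is constant on a large set, then for some [x] the remainder need not tend to [0] for
    almost every [y]. With the integrals exchanged, the inner one over [x] tends to [0] for every
    [y], and dominated convergence in [y] concludes. *)
Lemma cvg_remainder (d : nat -> R) : (forall n, 0 < d n) -> d @ \oo --> 0 ->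
  norm1 (fun x => \int[mu]_(y in I) `|remainder rho (T y) (v y) (d n) x|)
    @[n --> \oo] --> (0 : R).
Proof.
move=> d0 cd.
have -> : (fun n => norm1 (fun x => \int[mu]_(y in I) absrem (d n) x y)) =
    (fun n => \int[mu]_(y in I) \int[mu]_(x in I) absrem (d n) x y).
  apply/funext => n.
  rewrite -(Rintegral01_fubini (mabsrem (d n)) (fun x y => absrem_le (d0 n)) int_absrem).
  by apply: eq_Rintegral => x _; rewrite ger0_norm//; apply: Rintegral_ge0 => y _; exact: normr_ge0.
rewrite -[X in _ --> X](Rintegral01_cst (0:R)).
apply: (@dominated_cvg01 _ _ _ (fun y => 20 * K * `|v y|)) => //.
- move=> n; apply: integrable01_measurable.
  exact: (integrable01_Rintegral2 (mabsrem (d n)) (fun x y => absrem_le (d0 n)) int_absrem).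
- by apply: aeW => y Iy; exact: (cvg_Rintegral01_remainder K0 rhoK).
- move=> n y Iy; rewrite ger0_norm; last by apply: Rintegral_ge0 => x _; exact: normr_ge0.
  rewrite -/(norm1 (remainder rho (T y) (v y) (d n))).
  apply: norm1_le => [|x Ix]; last exact: (remainder_le K0 rhoK).
  by apply: (measurable_remainder K0 rhoK) => //; exact: measurable_cst.
Qed.

Let int_fold f B (T' w : R -> R) x : measurable_fun setT f -> (forall u, `|f u| <= B) ->
  measurable_fun I T' -> integrable01 w ->
  integrable01 (fun y => fold 2 f (T' y) x * w y).
Proof.
move=> mf fB mT' intw; apply: (le_integrable01 (g := fun y => 10 * B * `|w y|)).
- apply: measurable_funM; last exact: integrable01_measurable.
  by apply: measurable_fold => //; exact: measurable_cst.
- by move=> y _; rewrite normrM ler_wpM2r// fold_norm_le.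
- by apply: integrable01Z; exact: integrable01_norm.
Qed.

Definition response (f : R -> R) x : R :=
  \int[mu]_(y in I) (P_pi (tau (- T y) drho) x * v y * f y).

Lemma responseE f x : I x ->
  response f x = \int[mu]_(y in I) (fold 2 drho (T y) x * v y * f y).
Proof.
move=> Ix; apply: eq_Rintegral => y /set_mem Iy; rewrite P_piE//.
- exact: drho_supp.
- exact: TI.
Qed.

Lemma response_ae_eq f g x : measurable_fun I f -> measurable_fun I g ->
  f = g %[ae mu in I] -> I x -> response f x = response g x.
Proof.
move=> mf mg fg Ix; rewrite !responseE//.
have mv2 : measurable_fun I (fun y => fold 2 drho (T y) x * v y).
  apply: measurable_funM => //; apply: measurable_fold => //; exact: measurable_cst.
apply: ae_eq01_Rintegral; [exact: measurable_funM|exact: measurable_funM|].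
by apply: filterS fg; [exact: (ae_filter_ringOfSetsType mu)|move=> y /= + Iy => ->].
Qed.

Let vf_integrable f B : measurable_fun I f -> (forall y, I y -> `|f y| <= B) ->
  integrable01 (fun y => v y * f y).
Proof.
move=> mf fB; apply: (le_integrable01 (g := fun y => B * `|v y|)).
- exact: measurable_funM.
- by move=> y Iy; rewrite normrM mulrC ler_wpM2r// fB.
- by apply: integrable01Z; exact: integrable01_norm.
Qed.

Lemma response_bounded_mean0 f B : measurable_fun I f ->
  (forall y, I y -> `|f y| <= B) ->
  bounded_mean0 (10 * K * B * norm1 v) (response f).
Proof.
move=> mf fB; have B0 : 0 <= B by exact: le_trans (fB 0 I01_0).
pose G x y := fold 2 drho (T y) x * v y * f y.
have mG : measurable_fun (I `*` I) (fun z : R * R => G z.1 z.2).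
  apply: measurable_funM; last exact: mcomp2.
  by apply: measurable_funM; [exact: mfoldT|exact: mcomp2].
have Gle x y : I x -> I y -> `|G x y| <= 10 * K * B * `|v y|.
  move=> _ Iy; rewrite !normrM -[leLHS]mulrA.
  rewrite [leRHS](_ : _ = 10 * K * (`|v y| * B)); last by ring.
  apply: ler_pM => //; first by apply: fold_norm_le => u; exact: drho_le.
  by rewrite ler_wpM2l// fB.
have inth : integrable01 (fun y => 10 * K * B * `|v y|).
  by apply: integrable01Z; exact: integrable01_norm.
have intG := integrable01_Rintegral1 mG Gle inth.
have RE x : I x -> response f x = \int[mu]_(y in I) G x y by exact: responseE.
split.
- apply: integrable01_measurable; apply: eq_integrable intG => // x /set_mem Ix.
  by rewrite /= RE.
- move=> x Ix; rewrite RE//.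
  have intx := integrable01_sectionx mG Gle inth Ix.
  apply: (le_trans (le_normr_Rintegral _ intx)) => //.
  rewrite /norm1 -RintegralZl//; last exact: integrable01_norm.
  apply: le_Rintegral => //; first exact: integrable01_norm.
  by move=> y Iy; exact: Gle.
- transitivity (\int[mu]_(x in I) \int[mu]_(y in I) G x y).
    by apply: eq_Rintegral => x /set_mem Ix; exact: RE.
  rewrite (Rintegral01_fubini mG Gle inth) -[RHS](Rintegral01_cst (0 : R)).
  apply: eq_Rintegral => y /set_mem Iy.
  transitivity (\int[mu]_(x in I) (v y * f y * fold 2 drho (T y) x)).
    by apply: eq_Rintegral => x _; rewrite /G; ring.
  rewrite RintegralZl//; first by rewrite Rintegral01_fold_drho ?mulr0//; exact: TI.
  apply: (bounded_integrable01 (B := 10 * K)) => [|x _].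
    by apply: measurable_fold => //; exact: measurable_cst.
  by apply: fold_norm_le; exact: drho_le.
Qed.

Lemma response_linearization (T1 t f : R -> R) (d B : R) x : 0 < d ->
  measurable_fun I T1 -> (forall y, I y -> I (T1 y)) -> integrable01 t ->
  T1 = (fun y => T y + d * v y + t y) %[ae mu in I] ->
  measurable_fun I f -> (forall y, I y -> `|f y| <= B) -> I x ->
  `|(integral_op (noise_kernel rho T1) f x - integral_op (noise_kernel rho T) f x) / d
     + response f x| <=
  B * (10 * K * norm1 t / d + \int[mu]_(y in I) `|remainder rho (T y) (v y) d x|).
Proof.
move=> d0 mT1 T1I intt T1E mf fB Ix.
have B0 : 0 <= B by exact: le_trans (fB 0 I01_0).
have mt := integrable01_measurable intt.
have intf := bounded_integrable01 mf fB.
pose T2 y := T y + d * v y + t y.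
have mTv : measurable_fun I (fun y => T y + d * v y).
  by apply: measurable_funD => //; exact: measurable_funM.
have mT2 : measurable_fun I T2 by exact: measurable_funD.
have kE T' : (forall y, I y -> I (T' y)) -> integral_op (noise_kernel rho T') f x =
    \int[mu]_(y in I) (fold 2 rho (T' y) x * f y).
  by move=> T'I; apply: eq_Rintegral => y /set_mem Iy; rewrite noise_kernelE.
have i1 := int_fold x mrho rho_le mT1 intf.
have i2 := int_fold x mrho rho_le mT2 intf.
have i0 := int_fold x mrho rho_le mT intf.
have iv := int_fold x mdrho (drho_le K0 rhoK) mT (vf_integrable mf fB).
have E1 : \int[mu]_(y in I) (fold 2 rho (T1 y) x * f y) =
    \int[mu]_(y in I) (fold 2 rho (T2 y) x * f y).
  apply: ae_eq01_Rintegral; [exact: integrable01_measurable i1|exact: integrable01_measurable i2|].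
  by apply: filterS T1E; [exact: (ae_filter_ringOfSetsType mu)|move=> y /= + Iy => ->].
rewrite kE// kE// E1 responseE// -RintegralB// -RintegralZr//; last exact: integrable01B.
have i3 : integrable01 (fun y => (fold 2 rho (T2 y) x * f y - fold 2 rho (T y) x * f y) / d).
  under [X in EFin \o X]funext do rewrite mulrC.
  by apply: integrable01Z; exact: integrable01B.
under [X in _ + X]eq_Rintegral do rewrite -mulrA.
rewrite -RintegralD//.
have i4 := integrable01D i3 iv.
apply: (le_trans (le_normr_Rintegral _ i4)) => //.
have irem : integrable01 (fun y => `|remainder rho (T y) (v y) d x|).
  exact: (integrable01_sectionx (mabsrem d) (fun x y => absrem_le d0) int_absrem Ix).
have it : integrable01 (fun y => 10 * K / d * `|t y|).
  by apply: integrable01Z; exact: integrable01_norm.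
have -> : B * (10 * K * norm1 t / d + \int[mu]_(y in I) `|remainder rho (T y) (v y) d x|) =
   \int[mu]_(y in I) (B * (10 * K / d * `|t y| + `|remainder rho (T y) (v y) d x|)).
  rewrite RintegralZl//; last exact: integrable01D.
  rewrite RintegralD// RintegralZl//; last exact: integrable01_norm.
  by rewrite -/(norm1 t) [10 * K / d * _]mulrAC.
apply: le_Rintegral => //.
- exact: integrable01_norm.
- by apply: integrable01Z; exact: integrable01D.
move=> y Iy.
(* The error [t] is handled by the Lipschitz bound, and the displacement [d * v] by the
   remainder. *)
have -> : (fold 2 rho (T2 y) x * f y - fold 2 rho (T y) x * f y) / d +
    fold 2 drho (T y) x * (v y * f y) =
  f y * ((fold 2 rho (T2 y) x - fold 2 rho (T y + d * v y) x) / d +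
         remainder rho (T y) (v y) d x).
  by rewrite /remainder; ring.
rewrite normrM ler_pM// ?fB// (le_trans (ler_normD _ _))// lerD2r.
rewrite normrM normfV (gtr0_norm d0) mulrAC ler_pM2r ?invr_gt0//.
apply: (le_trans (fold_lipschitz _ _ _ _ rhoK)).
by rewrite subrr normr0 addr0 /T2 [X in `|X|]addrAC subrr add0r mulrA.
Qed.

End response.
End noise_kernel.

(** * Reduction to the resolvent equation, in L^2 *)

Section density_difference.
Context {R : realType}.
Local Notation mu := (@lebesgue_measure R).
Local Notation I := (I01 R).
Local Notation integrable01 f := (mu.-integrable I (EFin \o f)).
#[local] Hint Extern 0 (measurable (I01 _)) => solve [exact: measurable_I01] : core.

(** The Lipschitz predicate provides all constants above some [m]; the maximum with [1] makes the
    chosen one positive. *)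
Lemma lipschitz_constant (rho : R -> R) : [lipschitz rho x | x in [set: R]] ->
  exists2 K : R, 0 < K & forall x y, `|rho x - rho y| <= K * `|x - y|.
Proof.
move=> [m [_ mP]]; exists (Num.max 1 (m + 1)); first by rewrite lt_max ltr01.
move=> x y; have := mP (Num.max 1 (m + 1)).
rewrite lt_max ltrDl ltr01 orbT => /(_ erefl) h.
exact: (h (x, y)).
Qed.

Variables (k k' : R -> R -> R) (M : R).
Hypothesis kP : stochastic_kernel k M.
Hypothesis k'P : stochastic_kernel k' M.
Local Notation L := (integral_op k).
Local Notation L' := (integral_op k').
Variables (S : (R -> R) -> R -> R) (CS : R).
Hypothesis hS : bounded_inverse_on_V L S.
Hypothesis hCS : forall g, V g -> (norm2 (S g) <= CS%:E * norm2 g)%E.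

(** [U] equals [S (U \- L U)], hence [S w], almost everywhere. Applying [S] once to the whole
    right-hand side avoids any appeal to its linearity. *)
Lemma norm2_le_bounded_inverse U w : V U -> V w -> U \- L U = w %[ae mu in I] ->
  (norm2 U <= CS%:E * norm2 w)%E.
Proof.
move=> VU Vw Uw; have [S1 S2 _ S4 _] := hS.
have VS : V (S w) by exact: (S1 w Vw).2.
have SU : S w = U %[ae mu in I].
  have h1 := S2 _ _ (S1 U VU).1 Vw Uw; have h2 := S4 U VU.
  by apply: filterS2 h1 h2; [exact: (ae_filter_ringOfSetsType mu)|move=> x /= + + Ix => -> // ->].
rewrite -(ae_eq_norm2 (V_measurable VS) (V_measurable VU) SU).
exact: hCS.
Qed.

(** With the pointwise invariant representatives, [u = (L' f' - L f) / d] satisfies [u - L u = w]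
    exactly. Adding [S q] gives a function almost everywhere equal to the error on the left, whose
    image under [Id - L] is [w + q0]. *)
Lemma norm2_density_difference (f f' q q0 : R -> R) (d : R) :
  invariant_density L f -> invariant_density L' f' -> V q0 ->
  (forall x, I x -> q x = q0 x) -> measurable_fun I q ->
  (norm2 (fun x => (f' x - f x) / d - - S q x)%R <=
    CS%:E * norm2 (fun x => (L' (L' f') x - L (L' f') x) / d + q0 x)%R)%E.
Proof.
move=> hf hf' Vq0 qq0 mq; have [S1 S2 S3 S4 _] := hS.
have Vq : V q by apply: (V_ae Vq0) => //; apply: eq_in_ae => x Ix; rewrite qq0.
have [_ VSq] := S1 q Vq.
have [L2f _ _] := hf; have [L2f' _ _] := hf'.
have mf := L2_measurable L2f; have mf' := L2_measurable L2f'.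
have [mg gB Lg g1 gf] := invariant_density_regular kP hf.
have [mg' g'B Lg' g'1 gf'] := invariant_density_regular k'P hf'.
have intg := bounded_integrable01 mg gB; have intg' := bounded_integrable01 mg' g'B.
pose u x := d^-1 * (L' f' x - L f x).
have intu : integrable01 u by apply: integrable01Z; exact: integrable01B.
have Vu : V u.
  apply: (@bounded_mean0_V _ (`|d^-1| * (M * norm1 f' + M * norm1 f))); split.
  - exact: integrable01_measurable.
  - move=> x Ix; rewrite normrM ler_wpM2l// (le_trans (ler_normB _ _))//.
    by rewrite lerD ?gB ?g'B.
  - rewrite RintegralZl//; last exact: integrable01B.
    by rewrite RintegralB// g1 g'1 subrr mulr0.
pose w x := (L' (L' f') x - L (L' f') x) / d.
have Lu x : I x -> u x - L u x = w x.
  move=> Ix; rewrite (integral_opZ kP)//; last exact: integrable01B.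
  by rewrite (integral_opB kP)// Lg// /w Lg'// /u; ring.
have Vw : V w.
  have [+ _] := S1 u Vu => VuL; apply: (V_ae VuL); last exact: eq_in_ae.
  apply: measurable_funM => //; apply: measurable_funB; apply: integrable01_measurable.
    exact: (integrable01_integral_op k'P).
  exact: (integrable01_integral_op kP).
pose U x := u x + S q x; have VU : V U by exact: V_add.
have mU' : measurable_fun I (fun x => (f' x - f x) / d - - S q x).
  apply: measurable_funB; first by apply: measurable_funM => //; exact: measurable_funB.
  by apply: measurableT_comp => //; exact: V_measurable.
have UU' : U = (fun x => (f' x - f x) / d - - S q x) %[ae mu in I].
  apply: filterS2 gf gf'; first exact: (ae_filter_ringOfSetsType mu).
  by move=> x /= h1 h2 Ix; rewrite /U /u h1// h2// opprK mulrC.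
rewrite -(ae_eq_norm2 (V_measurable VU) mU' UU').
apply: norm2_le_bounded_inverse => //; first exact: V_add.
apply: filterS (S3 q Vq); first exact: (ae_filter_ringOfSetsType mu).
move=> x /= h Ix; rewrite /U (integral_opD kP)//; last exact: V_integrable.
by rewrite opprD addrACA Lu// h// qq0.
Qed.

End density_difference.

(** * L^1 size of the displacement of the map *)

Section Displacement.
Context {R : realType}.
Local Notation mu := (@lebesgue_measure R).
#[local] Hint Extern 0 (measurable (I01 _)) => solve [exact: measurable_I01] : core.

Lemma Rintegral_displacement_le (K d : R) (T T1 v t : R -> R) : 0 <= K -> 0 <= d ->
  measurable_fun (I01 R) T -> measurable_fun (I01 R) T1 ->
  mu.-integrable (I01 R) (EFin \o v) -> mu.-integrable (I01 R) (EFin \o t) ->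
  T1 = (fun y => T y + d * v y + t y) %[ae mu in I01 R] ->
  \int[mu]_(y in I01 R) (K * `|T1 y - T y|) <= K * (d * norm1 v + norm1 t).
Proof.
move=> K0 d0 mT mT1 intv intt T1E.
have int1 : mu.-integrable (I01 R) (EFin \o (fun y => d * v y + t y)).
  by apply: integrable01D => //; exact: integrable01Z.
have int2 : mu.-integrable (I01 R) (EFin \o (fun y => d * `|v y|)).
  by apply: integrable01Z; exact: integrable01_norm.
have -> : \int[mu]_(y in I01 R) (K * `|T1 y - T y|) =
          \int[mu]_(y in I01 R) (K * `|d * v y + t y|).
  apply: ae_eq01_Rintegral.
  - apply: measurable_funM => //; apply: measurableT_comp => //.
    exact: measurable_funB.
  - apply: measurable_funM => //; apply: measurableT_comp => //.
    exact: integrable01_measurable.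
  - apply: filterS T1E; first exact: (ae_filter_ringOfSetsType mu).
    by move=> y /= h Iy; rewrite h//; congr (_ * `|_|); ring.
rewrite RintegralZl//; last exact: (integrable01_norm int1).
rewrite ler_wpM2l//.
have -> : d * norm1 v + norm1 t = \int[mu]_(y in I01 R) (d * `|v y| + `|t y|).
  rewrite RintegralD//; last exact: (integrable01_norm intt).
  by rewrite RintegralZl//; exact: (integrable01_norm intv).
apply: le_Rintegral => //.
- exact: (integrable01_norm int1).
- by apply: integrable01D => //; exact: integrable01_norm.
- by move=> y _; rewrite (le_trans (ler_normD _ _))// normrM (ger0_norm d0).
Qed.

End Displacement.

(** * The linear response formula *)

Theorem proposition6p3 (R : realType) (dbar : R) (hdbar : 0 < dbar)
    (T : R -> R -> R) (Tdot : R -> R) (t : R -> R -> R) (rho : R -> R)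
    (hTmeas : forall d : R, 0 <= d < dbar -> measurable_fun (I01 R) (T d))
    (hT01 : forall d : R, 0 <= d < dbar -> forall x, I01 R x -> I01 R (T d x))
    (hTdot : L2 Tdot)
    (ht : forall d : R, 0 <= d < dbar -> L2 (t d))
    (hT : forall d : R, 0 <= d < dbar ->
       T d = (fun x => T 0 x + d * Tdot x + t d x)
         %[ae @lebesgue_measure R in I01 R])
    (hto : fine (norm2 (t d)) / d @[d --> 0^'+] --> 0)
    (hrho : probability_density rho)
    (hrho_lip : [lipschitz rho x | x in [set: R]])
    (hrho_supp : forall x : R, x \notin `[-1, 1] -> rho x = 0)
    (hA1 : forall g, V g ->
       norm2 (iter n (integral_op (noise_kernel rho (T 0))) g)
         @[n --> \oo] --> 0%E) :
  let drho := (rho^`())%classic in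
  let L d := integral_op (noise_kernel rho (T d)) in
  Vker (fun x y => - P_pi (tau (- T 0 y) drho) x * Tdot y) /\
  (exists S, bounded_inverse_on_V (L 0) S) /\
  exists d1 : R,
    [/\ 0 < d1 <= dbar,
        forall d : R, 0 <= d < d1 ->
          exists2 f, invariant_density (L d) f &
            forall g, invariant_density (L d) g ->
              g = f %[ae @lebesgue_measure R in I01 R] &
        forall (S : (R -> R) -> R -> R) (f : R -> R -> R),
          bounded_inverse_on_V (L 0) S ->
          (forall d : R, 0 <= d < d1 -> invariant_density (L d) (f d)) ->
          norm2 (fun x =>
            (f d x - f 0 x) / d -
            - S (fun x => \int[@lebesgue_measure R]_(y in I01 R)
                   (P_pi (tau (- T 0 y) drho) x * Tdot y * f 0 y)) x)
            @[d --> 0^'+] --> 0%E].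
Proof.
move=> drho L.
have [K K0 rhoK] := lipschitz_constant hrho_lip.
have h0 : 0 <= (0 : R) < dbar by rewrite lexx.
have mT0 := hTmeas 0 h0; have TI0 := hT01 0 h0.
have [intv _] := norm1_le_norm2 hTdot.
pose M : R := 10 * (3 * K); pose k d := noise_kernel rho (T d).
have kP d : 0 <= d < dbar -> stochastic_kernel (k d) M.
  by move=> hd; apply: (noise_kernel_stochastic K0 rhoK) => //; [exact: hTmeas|exact: hT01].
have k0P := kP 0 h0.
(* Only the L^1 consequence of (A1), on bounded functions, enters the contraction argument. *)
have kmix g B : bounded_mean0 B g -> norm1 (iter n (L 0) g) @[n --> \oo] --> (0 : R).
  move=> gB.
  have cN : fine (norm2 (iter n (L 0) g)) @[n --> \oo] --> (0 : R).
    by apply: fine_cvg; exact: hA1 _ (bounded_mean0_V gB).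
  apply: (squeeze_cvgr _ (cvg_cst 0) cN); apply: nearW => n; rewrite norm1_ge0/=.
  have [mg gle _] := gB; have intg := bounded_mean0_integrable gB.
  apply: (norm1_le_norm2 (bounded_L2 _ _)).2.
    by apply: integrable01_measurable; exact: (integrable01_iter_integral_op k0P).
  by move=> x Ix; exact: (iter_integral_op_le k0P n mg gle Ix).
have [N hN] := mixing_contracts k0P (fun x x' y => noise_kernel_lipschitz rhoK hrho_supp TI0) kmix.
have ck0 : contracting (k 0).
  exists N => g B gB x Ix; apply: (le_trans (hN g B gB x Ix)).
  by rewrite ler_wpM2r ?(bounded_mean0_ge0 gB)//; lra.
have [C [C0 stable]] := contracting_stable k0P ck0.
split; first exact: (Vker_response K0 rhoK).
split; first exact: (contracting_bounded_inverse k0P ck0).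
pose E d y := 10 * K * `|T d y - T 0 y|.
have intE d : 0 <= d < dbar -> lebesgue_measure.-integrable (I01 R) (EFin \o E d).
  move=> hd; apply: (bounded_integrable01 (B := 10 * K)).
    apply: measurable_funM => //; apply: measurableT_comp => //.
    by apply: measurable_funB => //; exact: hTmeas.
  move=> y Iy; have /I01P/andP[a1 a2] := hT01 d hd y Iy; have /I01P/andP[b1 b2] := TI0 y Iy.
  have K10 : 0 <= 10 * K by rewrite mulr_ge0// ltW.
  rewrite /E normrM normr_id ger0_norm// ler_piMr// ler_norml.
  by apply/andP; split; lra.
have kE d x y : 0 <= d < dbar -> I01 R x -> I01 R y -> `|k d x y - k 0 x y| <= E d y.
  by move=> hd; apply: noise_kernel_perturb => //; exact: hT01.
pose eps d := \int[lebesgue_measure]_(y in I01 R) E d y.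
pose rate d := fine (norm2 (t d)) / d.
(* The [+ 1] absorbs [t d]: its L^1 norm is at most [d] as soon as [rate d < 1]. *)
pose A := 10 * K * (norm1 Tdot + 1).
have A0 : 0 < A by rewrite mulr_gt0 ?mulr_gt0// ltr_wpDl// norm1_ge0.
have epsE d : 0 < d < dbar -> eps d <= 10 * K * (d * norm1 Tdot + norm1 (t d)).
  move=> /andP[d0 dd]; have hd : 0 <= d < dbar by rewrite (ltW d0).
  have [intt _] := norm1_le_norm2 (ht d hd).
  have K10 : 0 <= 10 * K by rewrite mulr_ge0// ltW.
  exact: (Rintegral_displacement_le K10 (ltW d0) mT0 (hTmeas d hd) intv intt (hT d hd)).
have [d0 d00 epsA] : exists2 d0, 0 < d0 & forall d, 0 <= d < d0 -> d < dbar -> eps d <= A * d.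
  have /cvgrPdist_lt/(_ 1 ltr01) := hto => -[e /= e0 he].
  (* The hypothesis on [t] is a limit from the right and is silent at [d = 0], where the
     displacement is zero. *)
  exists e => // d /andP[dge0 de] dd; move: dge0; rewrite le_eqVlt => /predU1P[<-|dgt0].
    have -> : eps 0 = \int[lebesgue_measure]_(y in I01 R) 0.
      by apply: eq_Rintegral => y _; rewrite /E subrr normr0 mulr0.
    by rewrite Rintegral01_cst mulr0.
  have hd : 0 <= d < dbar by rewrite ltW.
  apply: (le_trans (epsE d _)); first by rewrite dgt0.
  rewrite /A -[leRHS]mulrA ler_wpM2l//; first by rewrite mulr_ge0// ltW.
  rewrite mulrDl mul1r mulrC lerD2l (le_trans (norm1_le_norm2 (ht d hd)).2)//.
  have := he d _ dgt0; rewrite /ball_ /= !sub0r !normrN (gtr0_norm dgt0) => /(_ de).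
  by move/(le_lt_trans (ler_norm _))/ltW; rewrite ler_pdivrMr// mul1r.
pose c := perturb_const M N.+1.
have c0 : 0 <= c by exact: (perturb_const_ge0 k0P).
(* A single threshold serves two purposes: [D * eps d <= 1 / 4] yields both the smallness
   [c * eps d <= 1 / 4] for the contraction and [C * eps d <= 1 / 2] for the comparison of
   densities. The [1] makes [D] positive. *)
pose D := c + C + 1; have D0 : 0 < D by rewrite ltr_wpDl// addr_ge0.
have DA : 0 < 4 * D * A by apply: mulr_gt0 A0; exact: mulr_gt0 D0.
pose d1 := Num.min dbar (Num.min d0 (4 * D * A)^-1).
have d1P d : 0 <= d < d1 -> [/\ 0 <= d < dbar, d < d0 & D * eps d <= 1 / 4].
  rewrite !lt_min => /andP[dge0 /and3P[ddbar dd0 dDA]].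
  rewrite dge0 ddbar; split => //.
  have h := epsA d _ ddbar; have {}h := h (introT andP (conj dge0 dd0)).
  apply: (le_trans (ler_wpM2l (ltW D0) h)).
  by move: dDA; rewrite -[X in _ < X]mul1r ltr_pdivlMr//; lra.
have d1gt0 : 0 < d1 by rewrite !lt_min hdbar d00 invr_gt0.
have d1eps d : 0 <= d < d1 -> c * eps d <= 1 / 4 /\ C * eps d <= 1 / 2.
  move=> /d1P[hd _ h].
  have e0 : 0 <= eps d.
    by apply: Rintegral_ge0 => y _; rewrite mulr_ge0// mulr_ge0// ltW.
  have ce : 0 <= c * eps d by rewrite mulr_ge0.
  have Ce : 0 <= C * eps d by rewrite mulr_ge0.
  by move: h; rewrite /D; split; lra.
have ckd d : 0 <= d < d1 -> contracting (k d).
  move=> hd; have [hd' _ _] := d1P d hd; have [ce _] := d1eps d hd.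
  exists N; apply: (contracts_perturb k0P (kP d hd') (intE d hd')) => // x y.
  exact: kE.
exists d1; split.
- by rewrite d1gt0/= ge_min lexx.
- move=> d hd; have [hd' _ _] := d1P d hd.
  exact: (invariant_density_unique (kP d hd') (ckd d hd)).
move=> S f hS hf.
have hf0 : invariant_density (L 0) (f 0) by apply: hf; rewrite lexx.
have [m0 B0le L00 i00 e00] := invariant_density_regular k0P hf0.
set B0 := M * norm1 (f 0) in B0le.
have B0ge0 : 0 <= B0 by exact: le_trans (B0le 0 I01_0).
have [_ _ _ _ [CS hCS]] := hS.
(* [f d] solves the fixed point equation only a.e.; [ft d] does so everywhere. *)
pose ft d := L d (f d).
pose q0 := response rho (T 0) Tdot (ft 0).
have q0B : bounded_mean0 (10 * K * B0 * norm1 Tdot) q0.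
  exact: (response_bounded_mean0 K0 rhoK hrho hrho_supp mT0 TI0 intv m0 B0le).
set q := fun x => \int[_]_(y in _) _.
have L2f0 : L2 (f 0) by have [] := hf0.
have qq0 x : I01 R x -> q x = q0 x.
  move=> Ix; apply: (response_ae_eq K0 rhoK hrho_supp mT0 TI0 intv) => //.
  - exact: L2_measurable.
  - exact: ae_eq_sym.
have mq : measurable_fun (I01 R) q.
  have [mq0 _ _] := q0B; apply: eq_measurable_fun mq0.
  by move=> x /set_mem Ix; rewrite qq0.
pose Gd d x := \int[lebesgue_measure]_(y in I01 R) `|remainder rho (T 0 y) (Tdot y) d x|.
(* The part of the error that is uniform in [x]. Its first term is the cost of replacing [ft d] by
   [ft 0], quadratic in [eps d] before the division by [d]; the second one is the contribution of
   [t d]. *)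
pose a d := 2 * C * B0 * A * A * d + B0 * (10 * K * rate d).
pose w d x := (L d (ft d) x - L 0 (ft d) x) / d.
have wq0 d x : 0 < d < d1 -> I01 R x -> `|w d x + q0 x| <= a d + B0 * Gd d x.
  move=> /andP[dgt0 dd1] Ix; have hd : 0 <= d < d1 by rewrite (ltW dgt0).
  have [hd' dd0 _] := d1P d hd; have [_ Ceps] := d1eps d hd.
  have [intt tle] := norm1_le_norm2 (ht d hd').
  have [md Bdle Ldd idd edd] := invariant_density_regular (kP d hd') (hf d hd).
  have kE' x1 y1 Ix1 Iy1 := kE d x1 y1 hd' Ix1 Iy1.
  have gle y : I01 R y -> `|ft d y - ft 0 y| <= 2 * (C * eps d * B0).
    exact: (density_perturb k0P (kP d hd') (intE d hd') kE' C0 stable Ceps m0 md B0le Bdle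
             L00 Ldd (etrans i00 (esym idd))).
  have int0 := bounded_integrable01 m0 B0le.
  have intd := bounded_integrable01 md Bdle.
  have mg : measurable_fun (I01 R) (fun y => ft d y - ft 0 y) by exact: measurable_funB.
  have P1 := integral_op_perturb k0P (kP d hd') (intE d hd') kE' mg gle Ix.
  have P2 := response_linearization K0 rhoK hrho_supp mT0 TI0 intv dgt0 (hTmeas d hd')
    (hT01 d hd') intt (hT d hd') m0 B0le Ix.
  rewrite (integral_opB (kP d hd') intd int0 Ix) (integral_opB k0P intd int0 Ix) in P1.
  (* The first summand pairs two small factors, the kernel difference and the density difference;
     the second is the linearization at the fixed density [ft 0]. *)
  have -> : w d x + q0 x =
      (L d (ft d) x - L d (ft 0) x - (L 0 (ft d) x - L 0 (ft 0) x)) / d +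
      ((L d (ft 0) x - L 0 (ft 0) x) / d + q0 x).
    rewrite /w addrA -mulrDl; congr (_ / d + _).
    have addend (r1 r2 r3 r4 : R) : r1 - r2 = r1 - r3 - (r2 - r4) + (r3 - r4) by ring.
    exact: addend.
  apply: (le_trans (ler_normD _ _)).
  rewrite /a -[leRHS]addrA; apply: lerD; last first.
    apply: (le_trans P2); rewrite -mulrDr ler_wpM2l// lerD2r -mulrA ler_wpM2l//.
      by rewrite mulr_ge0// ltW.
    by rewrite ler_wpM2r// invr_ge0 ltW.
  rewrite normrM normfV (gtr0_norm dgt0) ler_pdivrMr//; apply: (le_trans P1).
  have e0 : 0 <= eps d.
    by apply: Rintegral_ge0 => y _; rewrite mulr_ge0// mulr_ge0// ltW.
  have eA : eps d <= A * d.
    by apply: epsA; [rewrite (ltW dgt0)|have /andP[] := hd'].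
  have -> : eps d * (2 * (C * eps d * B0)) = 2 * C * B0 * (eps d * eps d) by ring.
  have -> : 2 * C * B0 * A * A * d * d = 2 * C * B0 * ((A * d) * (A * d)) by ring.
  have CB0 : 0 <= 2 * C * B0 by apply: mulr_ge0 B0ge0; exact: mulr_ge0.
  by rewrite ler_wpM2l// ler_pM.
(* Product of a sup bound and an L^1 bound of [w d + q0], as required by [norm2_interpolation]. The
   first factor merely stays bounded; the second tends to [0]. *)
pose nu d := (a d + B0 * (20 * K * norm1 Tdot)) * (a d + B0 * norm1 (Gd d)).
have nu0 : nu d @[d --> 0^'+] --> (0 : R).
  have ac : a d @[d --> 0^'+] --> (0 : R).
    rewrite [X in _ --> X](_ : 0 = 2 * C * B0 * A * A * 0 + B0 * (10 * K * 0)); last first.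
      by rewrite !mulr0 addr0.
    apply: cvgD; apply: cvgMl_tmp; last exact: cvgMl_tmp.
    by apply: cvg_at_right_filter; exact: cvg_id.
  have Gc : norm1 (Gd d) @[d --> 0^'+] --> (0 : R).
    (* Dominated convergence is about sequences, so the right limit is tested along sequences of
       positive numbers. *)
    apply/cvg_at_rightP => u [u0 uc]; exact: (cvg_remainder K0 rhoK mT0 intv u0 uc).
  rewrite [X in _ --> X](_ : 0 = (0 + B0 * (20 * K * norm1 Tdot)) * (0 + B0 * 0)); last first.
    by rewrite !mulr0 addr0 mulr0.
  apply: cvgM; apply: cvgD => //; [exact: cvg_cst|exact: cvgMl_tmp].
have bound d : 0 < d < d1 ->
    (norm2 (fun x => (f d x - f 0 x) / d - - S q x)%R <= (`|CS| * Num.sqrt (nu d))%:E)%E.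
  move=> hd; have /andP[dgt0 dd1] := hd.
  have hd0 : 0 <= d < d1 by rewrite ltW.
  have [hd' _ _] := d1P d hd0.
  apply: (le_trans (norm2_density_difference k0P (kP d hd') hS hCS d hf0 (hf d hd0) (bounded_mean0_V q0B) qq0 mq)).
  have [md Bdle _ _ _] := invariant_density_regular (kP d hd') (hf d hd0).
  have intd := bounded_integrable01 md Bdle.
  have mw : measurable_fun (I01 R) (fun x => w d x + q0 x).
    have [mq0 _ _] := q0B; apply: measurable_funD => //; apply: measurable_funM => //.
    apply: measurable_funB; apply: integrable01_measurable.
      exact: (integrable01_integral_op (kP d hd') intd).
    exact: (integrable01_integral_op k0P intd).
  have wB x : I01 R x -> `|w d x + q0 x| <= a d + B0 * (20 * K * norm1 Tdot).
    move=> Ix; apply: (le_trans (wq0 d x hd Ix)); rewrite lerD2l ler_wpM2l//.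
    exact: (Rintegral_remainder_le K0 rhoK mT0 intv dgt0 Ix).
  have wN : norm1 (fun x => w d x + q0 x) <= a d + B0 * norm1 (Gd d).
    have intG := integrable01_norm (integrable01_remainder K0 rhoK mT0 intv dgt0).
    have intc : lebesgue_measure.-integrable (I01 R) (EFin \o (fun=> a d)).
      exact: integrable01_cst.
    have intBG := integrable01Z B0 intG.
    have -> : a d + B0 * norm1 (Gd d) =
        \int[lebesgue_measure]_(x in I01 R) (a d + B0 * `|Gd d x|).
      rewrite (RintegralD _ intc intBG); last exact: measurable_I01.
      congr (_ + _); first exact: (esym (Rintegral01_cst _)).
      by rewrite -(RintegralZl _ _ intG); last exact: measurable_I01.
    apply: le_Rintegral => //; first exact: measurable_I01.
    - exact: integrable01_norm (bounded_integrable01 mw wB).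
    - exact: integrable01D intc intBG.
    - move=> x Ix; apply: (le_trans (wq0 d x hd Ix)).
      by rewrite lerD2l ler_wpM2l// ler_norm.
  have B0w : 0 <= a d + B0 * (20 * K * norm1 Tdot) by exact: le_trans (wB 0 I01_0).
  (* The bound [CS] comes without a sign, hence the absolute value. *)
  apply: (@le_trans _ _ (`|CS|%:E * norm2 (fun x => w d x + q0 x)%R)%E).
    by rewrite lee_wpmul2r ?norm2_ge0// lee_fin ler_norm.
  rewrite EFinM lee_wpmul2l ?lee_fin//; apply: (le_trans (norm2_interpolation mw wB)).
  by rewrite lee_fin ler_wsqrtr// /nu ler_wpM2l.
apply: (@squeeze_cvge _ _ _ _ (cst 0%E) _ (fun d => (`|CS| * Num.sqrt (nu d))%:E)).
- near=> d; rewrite norm2_ge0/=; apply: bound; apply/andP; split; near: d.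
  + exact: nbhs_right_gt.
  + exact: nbhs_right_lt.
- exact: cvg_cst.
- apply: cvg_EFin; first exact: nearW.
  rewrite -[X in _ --> X](mulr0 `|CS|); apply: cvgMl_tmp.
  rewrite -[X in _ --> X](sqrtr0 R); apply: continuous_cvg nu0.
  exact: sqrt_continuous.
Unshelve. all: by end_near.
Qed.
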